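(* Fix a Higgs tensor $\xi$ on a $2$-dimensional torus (complex dimension $2$), and suppose that either $\mathrm{Re}(\xi)$ and $\mathrm{Im}(\xi)$ are (positive or negative) semidefinite, or $\det(\xi)=0$. Then there is at most one symplectic potential $u$, up to an additive constant, that satisfies $\|\xi\|^2_u<1$ and solves the real moment map equation $$\left(-\tfrac{1}{2}G^{ab}+(\check{\alpha}\,\xi\, G\,\bar{\xi})^{ab}\right)_{,ab}=0,\qquad G=D^2u.$$
   Context: The abelian surface is $M=\mathbb{C}^2/(\mathbb{Z}^2+\mathrm{i}\mathbb{Z}^2)$, and $\mathbb{T}=\mathbb{R}^2/\mathbb{Z}^2$ has coordinates $\boldsymbol y$. A symplectic potential is $u(\boldsymbol y)=\frac12|\boldsymbol y|^2+(\text{smooth periodic function})$ with positive definite Hessian $G=D^2u$, $(G^{ab})=G^{-1}$. A Higgs tensor is a smooth function $\xi$ on $\mathbb{T}$ with values in complex symmetric $2\times2$ matrices. $\|\xi\|^2_u=\mathrm{Tr}(\xi\,G\,\bar\xi\,G)$, and the inequality is required at every point. $\check\alpha=\psi(\xi G\bar\xi G)$, $\psi(x)=\frac12(1+\sqrt{1-x})^{-1}$ (functional calculus; $\xi G\bar\xi G$ has real non-negative eigenvalues). Subscripts after a comma denote derivatives in $\boldsymbol y$; repeated indices are summed. *)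

(* Defs.v *)
From HB Require Import structures.
From mathcomp Require Import all_boot all_order all_algebra.
From mathcomp Require Import all_classical all_reals all_analysis.
From mathcomp Require Export complex.
Set Implicit Arguments.
Unset Strict Implicit.
Unset Printing Implicit Defensive.
Import Order.TTheory GRing.Theory Num.Theory numFieldNormedType.Exports.
Local Open Scope classical_set_scope.
Local Open Scope ring_scope.
Local Open Scope complex_scope.

Section HiggsAbelianSurface.
Variable R : realType.

(* Functions on the torus R^2/Z^2 are represented by their Z^2-periodic lifts
   to R^2 = 'rV[R]_2. *)
Definition periodic (T : Type) (f : 'rV[R]_2 -> T) : Prop :=
  forall (y : 'rV[R]_2) (k : 'rV[int]_2), f (y + map_mx intr k) = f y.

Definition partial (a : 'I_2) (f : 'rV[R]_2 -> R) : 'rV[R]_2 -> R :=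
  fun y => 'D_(delta_mx 0 a) f y.

Definition smooth (f : 'rV[R]_2 -> R) : Prop :=
  forall s : seq 'I_2,
    continuous (foldr partial f s) /\
    forall (a : 'I_2) (y : 'rV[R]_2),
      derivable (foldr partial f s) y (delta_mx 0 a).

Definition cpartial (a : 'I_2) (f : 'rV[R]_2 -> R[i]) : 'rV[R]_2 -> R[i] :=
  fun y => partial a (fun z => complex.Re (f z)) y
           +i* partial a (fun z => complex.Im (f z)) y.

Definition quad (A : 'M[R]_2) (x : 'rV[R]_2) : R := (x *m A *m x^T) 0 0.

Definition posdefmx (A : 'M[R]_2) : Prop :=
  A^T = A /\ forall x : 'rV[R]_2, x != 0 -> 0 < quad A x.

Definition semidefmx (A : 'M[R]_2) : Prop :=
  A^T = A /\ ((forall x : 'rV[R]_2, 0 <= quad A x) \/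
              (forall x : 'rV[R]_2, quad A x <= 0)).

Definition hessian (u : 'rV[R]_2 -> R) (y : 'rV[R]_2) : 'M[R]_2 :=
  \matrix_(a < 2, b < 2) partial b (partial a u) y.

Definition symplectic_potential (u : 'rV[R]_2 -> R) : Prop :=
  (exists v : 'rV[R]_2 -> R,
     [/\ smooth v, periodic v
       & forall y, u y = 2^-1 * (\sum_(a < 2) y 0 a ^+ 2) + v y]) /\
  forall y, posdefmx (hessian u y).

Definition re_mx (A : 'M[R[i]]_2) : 'M[R]_2 := map_mx (@complex.Re R) A.
Definition im_mx (A : 'M[R[i]]_2) : 'M[R]_2 := map_mx (@complex.Im R) A.
Definition conj_mx (A : 'M[R[i]]_2) : 'M[R[i]]_2 := map_mx Num.conj A.

Definition higgs_tensor (xi : 'rV[R]_2 -> 'M[R[i]]_2) : Prop :=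
  [/\ periodic xi, forall y, (xi y)^T = xi y
    & forall a b : 'I_2, smooth (fun y => re_mx (xi y) a b) /\
                         smooth (fun y => im_mx (xi y) a b)].

(* Functional calculus f(X) for a diagonalisable complex matrix X with real
   spectrum: if X = P^-1 diag(d) P with d real then f(X) = P^-1 diag(f(d)) P,
   which does not depend on the choice of (P, d).  The value on the other
   matrices is the junk value 0. *)
Definition is_funcalc (f : R -> R) (X Y : 'M[R[i]]_2) : Prop :=
  exists (P : 'M[R[i]]_2) (d : 'rV[R]_2),
    [/\ P \in unitmx,
        X = invmx P *m diag_mx (map_mx (real_complex R) d) *m P
      & Y = invmx P *m diag_mx (map_mx (fun t => (f t)%:C) d) *m P].

Definition funcalc (f : R -> R) (X : 'M[R[i]]_2) : 'M[R[i]]_2 :=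
  xget 0 [set Y | is_funcalc f X Y].

Definition psi (x : R) : R := 2^-1 * (1 + Num.sqrt (1 - x))^-1.

Section MomentMap.
Variables (xi : 'rV[R]_2 -> 'M[R[i]]_2) (u : 'rV[R]_2 -> R).

Definition chessian (y : 'rV[R]_2) : 'M[R[i]]_2 :=
  map_mx (real_complex R) (hessian u y).

Definition xiGxibarG (y : 'rV[R]_2) : 'M[R[i]]_2 :=
  xi y *m chessian y *m conj_mx (xi y) *m chessian y.

(* This trace is a real number, stored in R[i]; z < 1 in R[i] means that z is
   real and less than 1. *)
Definition higgs_norm2 (y : 'rV[R]_2) : R[i] := \tr (xiGxibarG y).

Definition alpha_check (y : 'rV[R]_2) : 'M[R[i]]_2 := funcalc psi (xiGxibarG y).

Definition moment_tensor (y : 'rV[R]_2) : 'M[R[i]]_2 :=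
  - (2^-1 *: invmx (chessian y))
  + alpha_check y *m xi y *m chessian y *m conj_mx (xi y).

Definition real_moment_map_equation : Prop :=
  forall y, \sum_(a < 2) \sum_(b < 2)
    cpartial b (cpartial a (fun z => moment_tensor z a b)) y = 0.

End MomentMap.

End HiggsAbelianSurface.

(* Main.v *)
(* Write X = xi G conj(xi) G, t = tr X, d = det X.  Functional calculus on 2x2
   matrices makes the real part of the moment tensor explicit:
     m(G) = (A G A + B G B - E G^-1) / (2 s),  A = Re xi,  B = Im xi,
   with E = 1 + sqrt (1 - t + d) and s = sqrt (E^2 - d) = tr (sqrt (1 - X)).
   The hypotheses on xi imply that Tr (A H A H) + Tr (B H B H) >= 0 for every real
   symmetric H, and this makes m strictly monotone:
   Tr ((m(G2) - m(G1)) (G2 - G1)) >= 0, with equality only for G1 = G2.  By the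
   two moment map equations this pairing, for the Hessians of u1 and u2, is the
   divergence of a periodic vector field.  A periodic divergence that is
   nonnegative vanishes, so the two Hessians agree, and u2 - u1 is periodic with
   zero Hessian. *)

Require Import Defs.
From HB Require Import structures.
From mathcomp Require Import all_boot all_order all_algebra.
From mathcomp Require Import all_classical all_reals all_analysis.
From mathcomp Require Import ring lra.
Import Order.TTheory GRing.Theory Num.Theory numFieldNormedType.Exports.
Local Open Scope ring_scope.
Local Open Scope complex_scope.

(** The monotonicity is pointwise algebra between two matrices, with no path of potentials. The
    difference H = G2 - G1 has no sign, and Tr (A H A H) can be negative when A and H are both
    indefinite; this is the obstacle that the hypotheses on [xi] remove. The remaining nonlinearity
    is confined to two scalars, t and r = sqrt (det G), because d = |det xi|^2 r^4. Four times the
    pairing is exactly a sum of three terms: a scalar J depending on (t1, r1), (t2, r2) and |det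
    xi|^2; the form at H times a positive factor; and a positive multiple of w - r1 r2, with w the
    polarized determinant of G1 and G2. The inequality w >= r1 r2 is the reason for working with r
    rather than det G. Calculus enters the monotonicity only through J, along a segment in the (t,
    r) plane. The bound 4 d < 1 needed there says that X has real eigenvalues with sum in [0, 1): 4
    d <= t^2 < 1. *)

(** * Rules for directional derivatives *)

Section DirectionalDerivatives.
Context {R : realType} {V : normedModType R}.
Implicit Types (f g : V -> R) (x v : V) (a b : R).

(** Restriction to the line through [x] lets the one-variable rules for the inverse and for
    composition with the square root serve every direction. *)
Lemma is_derive_line f x v a :
  is_derive x v f a <-> is_derive (0 : R) 1 (fun h => f (h *: v + x)) a.
Proof.
have E : (fun h : R => h^-1 *: ((f \o shift x) (h *: v) - f x)) =
  (fun h : R => h^-1 *: (((fun h => f (h *: v + x)) \o shift 0) (h *: 1)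
     - f (0 *: v + x))).
  by apply/funext => h /=; rewrite addr0 scale0r add0r [h *: 1]mulr1.
split=> -[fd fE]; split; rewrite /derivable /derive.
- by rewrite -E.
- by rewrite -E.
- by rewrite E.
- by rewrite E.
Qed.

Lemma is_derive_add f g x v a b : is_derive x v f a -> is_derive x v g b ->
  is_derive x v (fun y => f y + g y) (a + b).
Proof. exact: is_deriveD. Qed.

Lemma is_derive_sub f g x v a b : is_derive x v f a -> is_derive x v g b ->
  is_derive x v (fun y => f y - g y) (a - b).
Proof. exact: is_deriveB. Qed.

Lemma is_derive_mul f g x v a b : is_derive x v f a -> is_derive x v g b ->
  is_derive x v (fun y => f y * g y) (a * g x + f x * b).
Proof.
move=> fa gb; have := is_deriveM fa gb.
by rewrite addrC [g x *: a]mulrC.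
Qed.

Lemma is_derive_const x v a : is_derive x v (fun=> a) (0 : R).
Proof. exact: is_derive_cst. Qed.

Lemma is_derive_inv f x v a : is_derive x v f a -> f x != 0 ->
  is_derive x v (fun y => (f y)^-1) (- (a * ((f x)^-1 * (f x)^-1))).
Proof.
move=> /is_derive_line fa fx0; apply/is_derive_line.
have fx0' : (fun h : R => f (h *: v + x)) 0 != 0 by rewrite scale0r add0r.
have := @is_deriveV _ _ _ _ _ fx0' fa.
rewrite scale0r add0r => H; apply: is_derive_eq.
by rewrite expr2 invfM /GRing.scale /=; ring.
Qed.

Lemma is_derive_sqrt f x v a : is_derive x v f a -> 0 < f x ->
  is_derive x v (fun y => Num.sqrt (f y)) (a * (2 * Num.sqrt (f x))^-1).
Proof.
move=> /is_derive_line fa fx0; apply/is_derive_line.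
have fx0' : 0 < (fun h : R => f (h *: v + x)) 0 by rewrite scale0r add0r.
have := @is_derive1_comp _ Num.sqrt (fun h : R => f (h *: v + x)) 0 _ _
  (is_derive1_sqrt fx0') fa.
by rewrite scale0r add0r mulrC.
Qed.

End DirectionalDerivatives.

(** * Monotonicity in the two scalar invariants t and r *)

Section ScalarMonotonicity.
Context {R : realType}.

(** Up to the factor s^-3, [Q] is the derivative of the scalar pairing along a segment, where e is
    the derivative of [dl] and p the logarithmic derivative of r. Completing the square in e leaves
    [p ^+ 2 * K]; the relation E - dl = 1 brings [K] to a form that is positive because 4 d < 1 <
    E. *)
Lemma quadratic_form_pos (dl d e p : R) : 0 < dl -> 0 <= d -> 4 * d < 1 ->
  let E := 1 + dl in
  let Q := 2 * dl * E * e ^+ 2 - 8 * d * dl * e * p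
           + p ^+ 2 * (4 * E ^+ 3 - 12 * E * d + 8 * d ^+ 2) in
  0 <= Q /\ (p != 0 -> 0 < Q).
Proof.
move=> dl0 d0 d1 E Q.
have E1 : 1 < E by rewrite /E; lra.
have E0 : 0 < 2 * dl * E by apply: mulr_gt0; lra.
set K := 2 * dl * E * (4 * E ^+ 3 - 12 * E * d + 8 * d ^+ 2)
         - 16 * d ^+ 2 * dl ^+ 2.
have QE : 2 * dl * E * Q = (2 * dl * E * e - 4 * d * dl * p) ^+ 2 + p ^+ 2 * K.
  by rewrite /Q /K; ring.
have K0 : 0 < K.
  have -> : K = 8 * dl * (E ^+ 2 * (E ^+ 2 - 3 * d) + 2 * d ^+ 2).
    by rewrite /K /E; ring.
  apply: mulr_gt0; first by lra.
  apply: ltr_wpDr; first by nra.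
  by apply: mulr_gt0; nra.
split.
  rewrite -(pmulr_rge0 _ E0) QE addr_ge0 ?sqr_ge0// mulr_ge0 ?sqr_ge0//.
  exact: ltW.
move=> p0; rewrite -(pmulr_rgt0 _ E0) QE ltr_wpDl ?sqr_ge0// mulr_gt0//.
by rewrite exprn_even_gt0.
Qed.

(* sqrt (det (1 - X)) and tr (sqrt (1 - X)) for t = tr X and d = det X *)
Definition sqrt_det (t d : R) : R := Num.sqrt (1 - t + d).
Definition trace_sqrt (t d : R) : R := Num.sqrt ((1 + sqrt_det t d) ^+ 2 - d).

Lemma sqrt_det_gt0 (t d : R) : t < 1 -> 0 <= d -> 0 < sqrt_det t d.
Proof. by move=> t1 d0; rewrite sqrtr_gt0; lra. Qed.

Lemma trace_sqrt_gt0 (t d : R) : t < 1 -> 0 <= d -> 4 * d < 1 ->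
  0 < (1 + sqrt_det t d) ^+ 2 - d.
Proof. by move=> t1 d0 d1; have := sqrt_det_gt0 _ _ t1 d0; nra. Qed.

Variables (k t1 t2 r1 r2 : R).
Hypotheses (k0 : 0 <= k) (r10 : 0 < r1) (r20 : 0 < r2).
Hypotheses (t11 : t1 < 1) (t21 : t2 < 1).
Hypotheses (d11 : 4 * (k * r1 ^+ 4) < 1) (d21 : 4 * (k * r2 ^+ 4) < 1).

(** A straight segment in the (t, r) plane with velocity (T, P); [h] pairs this velocity with the
    field (1 / s, - 4 E / (s r)). Products replace powers so that [is_derive_mul] applies as it
    stands. *)
Let T := t2 - t1.
Let P := r2 - r1.
Let t (x : R) : R := t1 + x * T.
Let r (x : R) : R := r1 + x * P.
Let d (x : R) : R := k * (r x * r x * (r x * r x)).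
Let dl (x : R) : R := Num.sqrt (1 - t x + d x).
Let E (x : R) : R := 1 + dl x.
Let s (x : R) : R := Num.sqrt (E x * E x - d x).
Let h (x : R) : R := T * (s x)^-1 - 4 * P * (E x * (s x * r x)^-1).

Lemma segment_bounds (x : R) : 0 <= x <= 1 ->
  [/\ 0 < r x, t x < 1, 0 <= d x & 4 * d x < 1].
Proof.
move=> /andP[x0 x1].
have convex_lt a1 a2 m : a1 < m -> a2 < m -> a1 + x * (a2 - a1) < m.
  move=> am1 am2; have [xm|xm] := leP (1 - x) 0; first by nra.
  have := mulr_gt0 xm (_ : 0 < m - a1); rewrite subr_gt0 => /(_ am1).
  have := mulr_ge0 x0 (_ : 0 <= m - a2); rewrite subr_ge0 => /(_ (ltW am2)).
  by lra.
have rx : 0 < r x.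
  have := convex_lt (- r1) (- r2) 0; rewrite !oppr_lt0 => /(_ r10 r20).
  by rewrite /r /P; lra.
have d0 : 0 <= d x by rewrite /d mulr_ge0// !mulr_ge0// ltW.
split=> //; first exact: convex_lt.
(* The bound on d is inherited from the endpoint with the larger r, since d increases with r > 0. *)
have : r x <= Num.max r1 r2.
  by rewrite /r /P le_max; case: (leP r1 r2) => ?; apply/orP; [right|left]; nra.
have dE y : k * (y * y * (y * y)) = k * y ^+ 4 by congr (_ * _); ring.
rewrite /d dE => rm.
have /le_lt_trans : 4 * (k * r x ^+ 4) <= 4 * (k * Num.max r1 r2 ^+ 4).
  by rewrite !ler_wpM2l// lerXn2r// ?nnegrE ?ltW// lt_max r10.
apply.
by case: (leP r1 r2).
Qed.

Lemma is_derive_segment (x : R) : 0 <= x <= 1 ->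
  let p : R := P / r x in let e : R := (4 * d x * p - T) / (2 * dl x) in
  is_derive x 1 h ((2 * dl x * E x * e ^+ 2 - 8 * d x * dl x * e * p
    + p ^+ 2 * (4 * E x ^+ 3 - 12 * E x * d x + 8 * d x ^+ 2)) / (s x) ^+ 3).
Proof.
move=> x01 p e.
have [rx tx dx0 dx1] := segment_bounds x x01.
have dlx : 0 < 1 - t x + d x by lra.
have dl0 : 0 < dl x by rewrite sqrtr_gt0.
have Es : 0 < E x * E x - d x by rewrite /E; nra.
have s0 : 0 < s x by rewrite sqrtr_gt0.
have Dt : is_derive x 1 t T.
  have := is_derive_add _ _ _ _ _ _ (is_derive_const x 1 t1)
    (is_derive_mul _ _ _ _ _ _ (is_derive_id x (1 : R)) (is_derive_const x 1 T)).
  by move/is_derive_eq; apply; ring.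
have Dr : is_derive x 1 r P.
  have := is_derive_add _ _ _ _ _ _ (is_derive_const x 1 r1)
    (is_derive_mul _ _ _ _ _ _ (is_derive_id x (1 : R)) (is_derive_const x 1 P)).
  by move/is_derive_eq; apply; ring.
have Dd : is_derive x 1 d (4 * d x * p).
  have Drr := is_derive_mul _ _ _ _ _ _ Dr Dr.
  have Dr4 := is_derive_mul _ _ _ _ _ _ Drr Drr.
  have := is_derive_mul _ _ _ _ _ _ (is_derive_const x 1 k) Dr4.
  move/is_derive_eq; apply; rewrite /d /p; field; exact: lt0r_neq0.
have Ddl : is_derive x 1 dl e.
  have D1 := is_derive_add _ _ _ _ _ _
    (is_derive_sub _ _ _ _ _ _ (is_derive_const x 1 1) Dt) Dd.
  have := is_derive_sqrt _ _ _ _ D1 dlx.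
  by move/is_derive_eq; apply; rewrite /e /dl; congr (_ / _); ring.
have DE : is_derive x 1 E e.
  have := is_derive_add _ _ _ _ _ _ (is_derive_const x 1 1) Ddl.
  by move/is_derive_eq; apply; ring.
have Ds : is_derive x 1 s ((E x * e - 2 * d x * p) / s x).
  have D1 := is_derive_sub _ _ _ _ _ _ (is_derive_mul _ _ _ _ _ _ DE DE) Dd.
  have := is_derive_sqrt _ _ _ _ D1 Es.
  by move/is_derive_eq; apply; rewrite -/(s x); field; exact: lt0r_neq0.
have sr0 : s x * r x != 0 by rewrite mulf_neq0// lt0r_neq0.
have D1 := is_derive_mul _ _ _ _ _ _ (is_derive_const x 1 T)
  (is_derive_inv _ _ _ _ Ds (lt0r_neq0 s0)).
have D2 := is_derive_mul _ _ _ _ _ _ (is_derive_const x 1 (4 * P))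
  (is_derive_mul _ _ _ _ _ _ DE
    (is_derive_inv _ _ _ _ (is_derive_mul _ _ _ _ _ _ Ds Dr) sr0)).
have := is_derive_sub _ _ _ _ _ _ D1 D2.
move/is_derive_eq; apply.
have s2 : s x ^+ 2 = E x * E x - d x by rewrite sqr_sqrtr// ltW.
have PE : P = p * r x by rewrite /p divfK// lt0r_neq0.
have TE : T = 4 * d x * p - 2 * dl x * e.
  rewrite /e [X in _ - X]mulrC divfK ?mulf_neq0 ?pnatr_eq0// ?lt0r_neq0//.
  by ring.
have dE : dl x = E x - 1 by rewrite /E; ring.
clear Dt Dr Dd Ddl DE Ds D1 D2; clearbody e; clearbody p.
move: (E x) (s x) (r x) (d x) (dl x) e p PE TE dE s2 s0 rx
  => E0 s1 r0 d0 dl1 e0 p0 -> -> -> s2 s0 rx.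
(* With d eliminated, the claim is a rational identity in E, s, r, e and p. *)
have -> : d0 = E0 * E0 - s1 ^+ 2 by rewrite s2; ring.
by field; rewrite !lt0r_neq0.
Qed.

(* J is the increment over [0, 1] of h, which is monotone along the segment from
   (t1, r1) to (t2, r2): its derivative is a positive quadratic form. *)
Lemma moment_scalar_monotone :
  let d r := k * r ^+ 4 in
  let E t r := 1 + sqrt_det t (d r) in
  let s t r := trace_sqrt t (d r) in
  let J := (t2 - t1) * ((s t2 r2)^-1 - (s t1 r1)^-1)
    + 4 * (r2 - r1) * (E t1 r1 / (s t1 r1 * r1) - E t2 r2 / (s t2 r2 * r2)) in
  0 <= J /\ (r1 != r2 -> 0 < J).
Proof.
move=> d' E' s' J.
have e0 : t 0 = t1 by rewrite /t; ring.
have e1 : t 1 = t2 by rewrite /t /T; ring.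
have f0 : r 0 = r1 by rewrite /r; ring.
have f1 : r 1 = r2 by rewrite /r /P; ring.
have dE y : d y = d' (r y) by rewrite /d /d'; congr (_ * _); ring.
have sE y : s y = s' (t y) (r y).
  by rewrite /s /s' /trace_sqrt /E /dl /sqrt_det dE expr2.
have EE y : E y = E' (t y) (r y) by rewrite /E /E' /dl /sqrt_det dE.
have JE : h 1 - h 0 = J.
  by rewrite /h /J !sE !EE e0 e1 f0 f1 -/T -/P; ring.
have itv (x : R) : x \in `]0, 1[%R -> 0 <= x <= 1.
  by rewrite in_itv /= => /andP[? ?]; rewrite !ltW.
have [c c01 hc] := @MVT _ h _ 0 1 ltr01 (fun x xI => is_derive_segment x (itv x xI))
  ltac:(apply: derivable_within_continuous => x;
        rewrite in_itv /= => xI; exact: (@ex_derive _ _ _ _ _ _ _ (is_derive_segment x xI))).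
have [rc tc dc0 dc1] := segment_bounds c (itv c c01).
have dlc : 0 < dl c by rewrite sqrtr_gt0; lra.
have sc : 0 < s c by rewrite sqrtr_gt0 /E; nra.
rewrite -JE hc subr0 mulr1.
have [Q0 Q1] := quadratic_form_pos (dl c) (d c)
  ((4 * d c * (P / r c) - T) / (2 * dl c)) (P / r c) dlc dc0 dc1.
split; first by apply: divr_ge0; [exact: Q0|exact/ltW/exprn_gt0].
move=> r12; apply: divr_gt0; last exact: exprn_gt0.
apply: Q1; apply: mulf_neq0; first by rewrite /P subr_eq0 eq_sym.
by rewrite invr_eq0 lt0r_neq0.
Qed.

End ScalarMonotonicity.

(** * Entrywise formulas for 2x2 matrices *)

Section TwoByTwo.
Context {F : comNzRingType}.
Implicit Types A B : 'M[F]_2.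

Lemma sum_ord2 (f : 'I_2 -> F) : \sum_i f i = f 0 + f 1.
Proof. by rewrite !big_ord_recl big_ord0 addr0; congr (_ + f _); exact: val_inj. Qed.

Lemma sum_sum_ord2 (f : 'I_2 -> 'I_2 -> F) :
  \sum_i \sum_j f i j = f 0 0 + f 0 1 + (f 1 0 + f 1 1).
Proof. by rewrite sum_ord2 2!sum_ord2. Qed.

Lemma mulmx2 A B i j : (A *m B) i j = A i 0 * B 0 j + A i 1 * B 1 j.
Proof. by rewrite mxE sum_ord2. Qed.

Lemma mxtrace2 A : \tr A = A 0 0 + A 1 1.
Proof. by rewrite /mxtrace sum_ord2. Qed.

Lemma det2 A : \det A = A 0 0 * A 1 1 - A 0 1 * A 1 0.
Proof.
rewrite (expand_det_row _ 0) sum_ord2 /cofactor !det_mx11 !mxE /=.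
have e0 : lift (0 : 'I_2) 0 = 1 by exact: val_inj.
have e1 : lift (1 : 'I_2) 0 = 0 by exact: val_inj.
by rewrite e0 e1 expr0 expr1; ring.
Qed.

Lemma matrix2P A B : A 0 0 = B 0 0 -> A 0 1 = B 0 1 -> A 1 0 = B 1 0 ->
  A 1 1 = B 1 1 -> A = B.
Proof.
move=> E00 E01 E10 E11; apply/matrixP => i j.
have ord2 (k : 'I_2) : k = 0 \/ k = 1.
  by case: k => [[|[|k]] kP] //; [left|right]; exact: val_inj.
by case: (ord2 i) => ->; case: (ord2 j) => ->.
Qed.

(* By Cayley-Hamilton this is the adjugate of A *)
Definition adj2 A : 'M[F]_2 := (\tr A)%:M - A.

Lemma mulmx_adj2 A : A *m adj2 A = (\det A)%:M.
Proof.
by apply: matrix2P; rewrite mulmx2 /adj2 !mxE mxtrace2 det2 /= ?mulr1n ?mulr0n; ring.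
Qed.

Lemma symmetric_entry A : A^T = A -> A 1 0 = A 0 1.
Proof. by move=> AT; rewrite -[in LHS]AT mxE. Qed.

End TwoByTwo.

Lemma invmx2 (F : fieldType) (A : 'M[F]_2) : \det A != 0 ->
  invmx A = (\det A)^-1 *: adj2 A.
Proof.
move=> dA; have uA : A \in unitmx by rewrite unitmxE unitfE.
rewrite -[RHS](mulKmx uA) -scalemxAr mulmx_adj2.
by rewrite -mul_scalar_mx -scalar_mxM mulVf// mulmx1.
Qed.

(** * Positive definite matrices, the Higgs form and monotonicity of the moment matrix *)

Section PositiveDefinite.
Context {R : realType}.
Implicit Types (A B G H : 'M[R]_2).

Lemma quad2 A (x : 'rV[R]_2) : quad A x =
  x 0 0 * x 0 0 * A 0 0 + x 0 0 * x 0 1 * (A 0 1 + A 1 0) + x 0 1 * x 0 1 * A 1 1.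
Proof.
rewrite /quad mxE sum_ord2 !mxE !sum_ord2; ring.
Qed.

Definition rV2 (a b : R) : 'rV[R]_2 := \row_(j < 2) if j == 0 then a else b.

Lemma rV2E a b : (rV2 a b 0 0 = a) * (rV2 a b 0 1 = b).
Proof. by rewrite !mxE. Qed.

Lemma posdef_entries G : posdefmx G ->
  [/\ G 1 0 = G 0 1, 0 < G 0 0, 0 < G 1 1 & 0 < \det G].
Proof.
move=> [GT Gpos]; have G10 := symmetric_entry _ GT.
have pos a b : (a != 0) || (b != 0) ->
    0 < a * a * G 0 0 + a * b * (G 0 1 + G 0 1) + b * b * G 1 1.
  move=> ab; have := Gpos (rV2 a b); rewrite quad2 !rV2E G10; apply.
  apply/eqP => /matrixP E; move: ab; have := E 0 0; have := E 0 1.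
  by rewrite !rV2E !mxE => -> ->; rewrite eqxx.
have G00 : 0 < G 0 0 by have := pos 1 0; rewrite oner_eq0 => /(_ isT); lra.
have G11 : 0 < G 1 1 by have := pos 0 1; rewrite eqxx oner_eq0 => /(_ isT); lra.
split=> //; rewrite det2 G10.
(* At this vector the quadratic form equals [G 0 0 * \det G]. *)
have := pos (- G 0 1) (G 0 0).
rewrite [G 0 0 != 0]lt0r_neq0 // orbT => /(_ isT).
have -> : - G 0 1 * - G 0 1 * G 0 0 + - G 0 1 * G 0 0 * (G 0 1 + G 0 1)
  + G 0 0 * G 0 0 * G 1 1 = G 0 0 * (G 0 0 * G 1 1 - G 0 1 * G 0 1) by ring.
by rewrite pmulr_rgt0.
Qed.

(** For xi = A + i B this is the real part of Tr (xi G conj(xi) H), the polarization of the squared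
    norm of the Higgs tensor. *)
Definition higgs_form A B G H : R :=
  \tr (A *m G *m A *m H) + \tr (B *m G *m B *m H).

(* |det (A + i B)|^2 *)
Definition det_norm2 A B : R :=
  (\det A - \det B) ^+ 2
  + (A 0 0 * B 1 1 + A 1 1 * B 0 0 - A 0 1 * B 1 0 - A 1 0 * B 0 1) ^+ 2.

(* With C the Cholesky factor of G, the left-hand side minus the right-hand
   side is the discriminant of N N^* for N = C (A + i B) C^T. *)
Lemma higgs_discriminant A B G : A^T = A -> B^T = B -> posdefmx G ->
  4 * (det_norm2 A B * \det G ^+ 2) <= higgs_form A B G G ^+ 2.
Proof.
move=> AT BT Gp; have [G10 G00 G11 dG] := posdef_entries G Gp.
have A10 := symmetric_entry _ AT; have B10 := symmetric_entry _ BT.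
set x := Num.sqrt (G 0 0); have x0 : 0 < x by rewrite sqrtr_gt0.
have xx : G 0 0 = x * x by rewrite -expr2 sqr_sqrtr// ltW.
set y := G 0 1 / x; have yE : G 0 1 = x * y by rewrite /y mulrC divfK// lt0r_neq0.
set z := Num.sqrt (\det G) / x.
have zE : G 1 1 = z * z + y * y.
  have := sqr_sqrtr (ltW dG); rewrite {2}det2 G10 => dE.
  apply: (mulfI (lt0r_neq0 G00)); rewrite mulrDr.
  have -> : G 0 0 * (z * z) = Num.sqrt (\det G) ^+ 2.
    by rewrite xx /z; field; exact: lt0r_neq0.
  have -> : G 0 0 * (y * y) = G 0 1 * G 0 1.
    by rewrite xx yE; ring.
  by rewrite dE; ring.
rewrite -subr_ge0.
(* [n1], [n2], [n3] are the entries (0,0), (0,1), (1,1) of C M C^T, for C upper triangular with rows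
   (x, y) and (0, z), so that G = C^T C. *)
pose n1 (M : 'M[R]_2) := x * x * M 0 0 + 2 * x * y * M 0 1 + y * y * M 1 1.
pose n2 (M : 'M[R]_2) := x * z * M 0 1 + y * z * M 1 1.
pose n3 (M : 'M[R]_2) := z * z * M 1 1.
have -> : higgs_form A B G G ^+ 2 - 4 * (det_norm2 A B * \det G ^+ 2) =
  (n1 A ^+ 2 + n1 B ^+ 2 - n3 A ^+ 2 - n3 B ^+ 2) ^+ 2
  + 4 * ((n1 A * n2 A + n1 B * n2 B + n3 A * n2 A + n3 B * n2 B) ^+ 2
         + (n1 B * n2 A - n1 A * n2 B + n3 A * n2 B - n3 B * n2 A) ^+ 2).
  rewrite /higgs_form !mxtrace2 !mulmx2 /det_norm2 !det2 A10 B10 G10 xx yE zE.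
  by rewrite /n1 /n2 /n3; ring.
apply: addr_ge0; first exact: sqr_ge0.
apply: mulr_ge0; first exact: ler0n.
by apply: addr_ge0; exact: sqr_ge0.
Qed.

Lemma semidefmx_det_ge0 A : semidefmx A -> 0 <= \det A.
Proof.
move=> [AT Asemi].
have key p q s : (forall a b : R, 0 <= a * a * p + a * b * (q + q) + b * b * s) ->
    0 <= p * s - q * q.
  move=> pos; have p0 : 0 <= p by have := pos 1 0; lra.
  have [p_gt0|p_le0] := ltP 0 p.
    by rewrite -(pmulr_rge0 _ p_gt0); have := pos (- q) p; lra.
  have pE : p = 0 by apply/le_anti; rewrite p_le0 p0.
  have [qE|q0] := eqVneq q 0; first by rewrite pE qE; lra.
  (* When p = 0 the form is affine in the first coordinate; this point makes it equal to -1 and so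
     excludes q <> 0. *)
  have := pos (- (s + 1) / (2 * q)) 1.
  have -> : - (s + 1) / (2 * q) * (- (s + 1) / (2 * q)) * p
    + - (s + 1) / (2 * q) * 1 * (q + q) + 1 * 1 * s = - 1.
    by rewrite pE; field.
  by lra.
have A10 := symmetric_entry _ AT.
have qE a b := quad2 A (rV2 a b); rewrite det2 A10.
case: Asemi => Aq.
  by apply: key => a b; have := Aq (rV2 a b); rewrite qE !rV2E A10.
have -> : A 0 0 * A 1 1 - A 0 1 * A 0 1
  = (- A 0 0) * (- A 1 1) - (- A 0 1) * (- A 0 1) by ring.
apply: key => a b; have := Aq (rV2 a b); rewrite qE !rV2E A10; lra.
Qed.

(** In Tr (M H M H) the matrix M occurs twice, so its sign cancels and semidefiniteness enters
    through det M >= 0: after multiplication by the square of [M 0 0] the trace is a sum of squares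
    with coefficients 1 and 2 det M. *)
Lemma higgs_form_ge0 A B : semidefmx A -> semidefmx B ->
  forall H, H^T = H -> 0 <= higgs_form A B H H.
Proof.
have key M H : semidefmx M -> H^T = H -> 0 <= \tr (M *m H *m M *m H).
  move=> Ms HT; have dM := semidefmx_det_ge0 _ Ms; case: Ms => MT _.
  have M10 := symmetric_entry _ MT; have H10 := symmetric_entry _ HT.
  rewrite mxtrace2 !mulmx2 M10 H10.
  move: dM; rewrite det2 M10; set p := M 0 0; set q := M 0 1; set s := M 1 1.
  set D := p * s - q * q; move=> dM.
  have [p0|p0] := eqVneq p 0.
    have q0 : q = 0 by apply/eqP; rewrite -sqrf_eq0; apply/eqP; move: dM;
      rewrite /D p0; have := sqr_ge0 q; lra.
    by rewrite p0 q0; have := sqr_ge0 (s * H 1 1); lra.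
  have pp : 0 < p ^+ 2 by rewrite exprn_even_gt0.
  rewrite -(pmulr_rge0 _ pp).
  rewrite [X in 0 <= X](_ : _ =
    (p ^+ 2 * H 0 0 + 2 * p * q * H 0 1 + q ^+ 2 * H 1 1) ^+ 2
    + (D * H 1 1) ^+ 2 + 2 * D * (p * H 0 1 + q * H 1 1) ^+ 2);
    last by rewrite /D; ring.
  apply: addr_ge0; first by apply: addr_ge0; exact: sqr_ge0.
  by apply: mulr_ge0; [lra|exact: sqr_ge0].
by move=> As Bs H HT; apply: addr_ge0; exact: key.
Qed.

(** A complex symmetric matrix of rank at most one is v v^T, and then the form at H is the square of
    the real number v^* H v. The proof carries this out in real coordinates. *)
Lemma higgs_form_det0 A B : A^T = A -> B^T = B -> det_norm2 A B = 0 ->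
  forall H, H^T = H -> 0 <= higgs_form A B H H.
Proof.
move=> AT BT d0 H HT.
have A10 := symmetric_entry _ AT; have B10 := symmetric_entry _ BT.
have H10 := symmetric_entry _ HT.
move/eqP: d0; rewrite /det_norm2 paddr_eq0 ?sqr_ge0// !sqrf_eq0 !det2 A10 B10.
move=> /andP[/eqP E1 /eqP E2].
rewrite /higgs_form !mxtrace2 !mulmx2 A10 B10 H10.
move: (A 0 0) (A 0 1) (A 1 1) (B 0 0) (B 0 1) (B 1 1) E1 E2.
move=> p q s p' q' s' E1 E2.
have [n0|n0] := eqVneq (p ^+ 2 + p' ^+ 2) 0.
  move/eqP: n0; rewrite paddr_eq0 ?sqr_ge0// !sqrf_eq0 => /andP[/eqP p0 /eqP p'0].
  rewrite p0 p'0 in E1 E2 *.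
  (* If the (0,0) entry vanishes, the determinant is minus the square of the off-diagonal entry;
     this is |z|^4 = |z^2|^2 for z = q + i q'. *)
  have : (q ^+ 2 + q' ^+ 2) ^+ 2 = 0.
    rewrite [LHS](_ : _ = (q * q - q' * q') ^+ 2 + (2 * q * q') ^+ 2); last by ring.
    have -> : q * q - q' * q' = 0 by lra.
    have -> : 2 * q * q' = 0 by lra.
    by ring.
  move/eqP; rewrite sqrf_eq0 paddr_eq0 ?sqr_ge0// !sqrf_eq0.
  move=> /andP[/eqP -> /eqP ->].
  by have := sqr_ge0 (s * H 1 1); have := sqr_ge0 (s' * H 1 1); lra.
have n_gt0 : 0 < p ^+ 2 + p' ^+ 2.
  by rewrite lt_def n0 addr_ge0 ?sqr_ge0.
(* Here and below: the real and imaginary parts of s + i s' = (q + i q')^2 / (p + i p'). *)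
have sE : s = (p * (q ^+ 2 - q' ^+ 2) + 2 * p' * q * q') / (p ^+ 2 + p' ^+ 2).
  apply: (mulIf n0); rewrite divfK//; apply/eqP; rewrite -subr_eq0; apply/eqP.
  rewrite [LHS](_ : _ = p * (p * s - q * q - (p' * s' - q' * q'))
    + p' * (p * s' + s * p' - q * q' - q * q')); last by ring.
  by rewrite E1 E2; ring.
have s'E : s' = (2 * p * q * q' - p' * (q ^+ 2 - q' ^+ 2)) / (p ^+ 2 + p' ^+ 2).
  apply: (mulIf n0); rewrite divfK//; apply/eqP; rewrite -subr_eq0; apply/eqP.
  rewrite [LHS](_ : _ = p * (p * s' + s * p' - q * q' - q * q')
    - p' * (p * s - q * q - (p' * s' - q' * q'))); last by ring.
  by rewrite E1 E2; ring.
rewrite -(pmulr_rge0 _ n_gt0) [X in 0 <= X](_ : _ =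
   ((p ^+ 2 + p' ^+ 2) * H 0 0 + 2 * (p * q + p' * q') * H 0 1
    + (q ^+ 2 + q' ^+ 2) * H 1 1) ^+ 2); last by rewrite sE s'E; field.
exact: sqr_ge0.
Qed.

Definition norm_det (A B G : 'M[R]_2) : R := det_norm2 A B * \det G ^+ 2.

(** The inverse of G is written through [adj2], so that pairing it with another matrix produces
    mixed determinants. *)
Definition moment_mx (A B G : 'M[R]_2) : 'M[R]_2 :=
  let t := higgs_form A B G G in let d := norm_det A B G in
  (2 * trace_sqrt t d)^-1 *:
    (A *m G *m A + B *m G *m B - ((1 + sqrt_det t d) / \det G) *: adj2 G).

Lemma norm_det_lt A B G : A^T = A -> B^T = B -> posdefmx G ->
  0 <= higgs_form A B G G < 1 -> 0 <= norm_det A B G /\ 4 * norm_det A B G < 1.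
Proof.
move=> AT BT Gp /andP[t0 t1]; have := higgs_discriminant A B G AT BT Gp.
rewrite -/(norm_det A B G) => dt.
split; first by rewrite /norm_det mulr_ge0// ?addr_ge0 ?sqr_ge0.
by apply: le_lt_trans dt _; rewrite expr_lt1.
Qed.

(** The mixed discriminant: the symmetric bilinear form whose value at (G, G) is det G. *)
Definition mixed_det (G1 G2 : 'M[R]_2) : R := 2^-1 * \tr (adj2 G1 *m G2).

Lemma mixed_detE G1 G2 : G1^T = G1 -> G2^T = G2 -> mixed_det G1 G2 =
  (G1 0 0 * G2 1 1 + G1 1 1 * G2 0 0) / 2 - G1 0 1 * G2 0 1.
Proof.
move=> /symmetric_entry G1_10 /symmetric_entry G2_10.
rewrite /mixed_det mxtrace2 !mulmx2 /adj2 !mxE mxtrace2.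
by rewrite /= ?mulr1n ?mulr0n G1_10 G2_10; field.
Qed.

(** The polynomial det (G2 - l G1) in l has real roots, and w^2 - det G1 det G2 is a quarter of its
    discriminant; [discE] writes it as a sum of squares. In the equality case both squares vanish,
    so G2 is proportional to G1, and equal determinants make the ratio 1. *)
Lemma mixed_det_ge G1 G2 : posdefmx G1 -> posdefmx G2 ->
  Num.sqrt (\det G1) * Num.sqrt (\det G2) <= mixed_det G1 G2 /\
  (\det G1 = \det G2 -> mixed_det G1 G2 = \det G1 -> G1 = G2).
Proof.
move=> G1p G2p.
have [G1_10 a1 c1 D1] := posdef_entries _ G1p.
have [G2_10 a2 c2 D2] := posdef_entries _ G2p.
have wE := mixed_detE _ _ (proj1 G1p) (proj1 G2p).
move: (mixed_det G1 G2) wE => w wE.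
set al := G1 0 0 * G2 0 1 - G1 0 1 * G2 0 0.
set be := G1 0 0 * (G1 0 0 * G2 1 1 - G1 1 1 * G2 0 0) - 2 * G1 0 1 * al.
have discE : 4 * (G1 0 0 * G1 0 0) * (w ^+ 2 - \det G1 * \det G2) =
  be ^+ 2 + 4 * \det G1 * al ^+ 2.
  by rewrite /be /al wE !det2 G1_10 G2_10; field.
have w0 : 0 < w.
  have a12 : 0 < 2 * (G1 0 0 * G2 0 0) by rewrite !mulr_gt0.
  rewrite -(pmulr_rgt0 _ a12).
  have -> : 2 * (G1 0 0 * G2 0 0) * w =
    G1 0 0 ^+ 2 * \det G2 + G2 0 0 ^+ 2 * \det G1 + al ^+ 2.
    by rewrite wE !det2 G1_10 G2_10 /al; field.
  apply: ltr_wpDr; first exact: sqr_ge0.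
  by rewrite addr_gt0// mulr_gt0// exprn_gt0.
have aa : 0 < 4 * (G1 0 0 * G1 0 0) by rewrite !mulr_gt0.
have al0 : 0 <= 4 * \det G1 * al ^+ 2.
  by rewrite mulr_ge0 ?sqr_ge0// mulr_ge0// ltW.
split.
  rewrite -ler_sqr ?nnegrE ?(ltW w0) ?mulr_ge0 ?sqrtr_ge0//.
  rewrite exprMn !sqr_sqrtr ?(ltW D1) ?(ltW D2)// -subr_ge0 -(pmulr_rge0 _ aa) discE.
  by rewrite addr_ge0// sqr_ge0.
move=> DE wD; move: discE; rewrite wD -DE -expr2 subrr mulr0 => /esym/eqP.
rewrite paddr_eq0 ?sqr_ge0// sqrf_eq0 => /andP[/eqP be_0 al_0].
have {}al_0 : al = 0.
  apply/eqP; rewrite -sqrf_eq0; move: al_0; rewrite mulf_eq0 => /orP[|//].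
  by rewrite gt_eqF// mulr_gt0.
have : G1 0 0 * (G1 0 0 * G2 1 1 - G1 1 1 * G2 0 0) = 0.
  by move: be_0; rewrite /be al_0; lra.
move/eqP; rewrite mulf_eq0 (gt_eqF a1) /= subr_eq0 => /eqP ceq.
move/eqP: al_0; rewrite /al subr_eq0 => /eqP beq.
have a0 := lt0r_neq0 a1.
have bE : G2 0 1 = G1 0 1 * G2 0 0 / G1 0 0 by rewrite -beq mulrC mulKf.
have cE : G2 1 1 = G1 1 1 * G2 0 0 / G1 0 0 by rewrite -ceq mulrC mulKf.
have : G1 0 0 ^+ 2 * \det G1 = G2 0 0 ^+ 2 * \det G1.
  by rewrite {1}DE !det2 G2_10 G1_10 bE cE; field.
move/(mulIf (lt0r_neq0 D1))/eqP; rewrite eqrXn2 ?(ltW a1) ?(ltW a2)// => /eqP aE.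
apply: matrix2P => //; rewrite ?G1_10 ?G2_10 ?bE ?cE -aE;
  by rewrite mulfK.
Qed.

(** The decomposition of 4 I into three nonnegative terms also gives the equality case: I = 0 forces
    r1 = r2 through J, then w = r1 r2 through the last term, and the equality case of [mixed_det_ge]
    applies. *)
Lemma moment_mx_monotone A B G1 G2 : A^T = A -> B^T = B ->
  (forall H, H^T = H -> 0 <= higgs_form A B H H) ->
  posdefmx G1 -> posdefmx G2 ->
  higgs_form A B G1 G1 < 1 -> higgs_form A B G2 G2 < 1 ->
  let I := \tr ((moment_mx A B G2 - moment_mx A B G1) *m (G2 - G1)) in
  0 <= I /\ (I = 0 -> G1 = G2).
Proof.
move=> AT BT form_ge0 G1p G2p t1lt t2lt I.
have [G1_10 G1_00 G1_11 D1] := posdef_entries _ G1p.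
have [G2_10 G2_00 G2_11 D2] := posdef_entries _ G2p.
have A10 := symmetric_entry _ AT; have B10 := symmetric_entry _ BT.
have t1ge := form_ge0 _ (proj1 G1p); have t2ge := form_ge0 _ (proj1 G2p).
have [d1ge d1lt] := norm_det_lt A B G1 AT BT G1p ltac:(by rewrite t1ge t1lt).
have [d2ge d2lt] := norm_det_lt A B G2 AT BT G2p ltac:(by rewrite t2ge t2lt).
have hge : 0 <= higgs_form A B (G2 - G1) (G2 - G1).
  by apply: form_ge0; rewrite linearB /= (proj1 G1p) (proj1 G2p).
have [w_ge w_eq] := mixed_det_ge _ _ G1p G2p.
have wE := mixed_detE _ _ (proj1 G1p) (proj1 G2p).
(* A reflexive equation whose right-hand side alone gets unfolded, so that the abbreviations below
   reach it while the left-hand side keeps [I]. *)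
have I4 : 4 * I = 4 * I by [].
rewrite {2}/I /moment_mx in I4.
set t1 := higgs_form A B G1 G1 in t1lt t1ge I4.
set t2 := higgs_form A B G2 G2 in t2lt t2ge I4.
set d1 := norm_det A B G1 in d1ge d1lt I4.
set d2 := norm_det A B G2 in d2ge d2lt I4.
set r1 := Num.sqrt (\det G1) in w_ge; set r2 := Num.sqrt (\det G2) in w_ge.
have r1_gt0 : 0 < r1 by rewrite sqrtr_gt0.
have r2_gt0 : 0 < r2 by rewrite sqrtr_gt0.
have r1E : \det G1 = r1 ^+ 2 by rewrite sqr_sqrtr// ltW.
have r2E : \det G2 = r2 ^+ 2 by rewrite sqr_sqrtr// ltW.
have d1E : d1 = det_norm2 A B * r1 ^+ 4.
  by rewrite /d1 /norm_det r1E -exprM.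
have d2E : d2 = det_norm2 A B * r2 ^+ 4.
  by rewrite /d2 /norm_det r2E -exprM.
have k0 : 0 <= det_norm2 A B by rewrite addr_ge0 ?sqr_ge0.
have /= := moment_scalar_monotone (det_norm2 A B) t1 t2 r1 r2 k0 r1_gt0 r2_gt0 t1lt t2lt
  ltac:(by rewrite -d1E) ltac:(by rewrite -d2E).
rewrite -d1E -d2E.
have s1_gt0 : 0 < trace_sqrt t1 d1 by rewrite sqrtr_gt0; exact: trace_sqrt_gt0.
have s2_gt0 : 0 < trace_sqrt t2 d2 by rewrite sqrtr_gt0; exact: trace_sqrt_gt0.
have E1_gt0 : 0 < 1 + sqrt_det t1 d1 by have := sqrt_det_gt0 t1 d1 t1lt d1ge; lra.
have E2_gt0 : 0 < 1 + sqrt_det t2 d2 by have := sqrt_det_gt0 t2 d2 t2lt d2ge; lra.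
set E1 := 1 + _ in E1_gt0 I4 *; set E2 := 1 + _ in E2_gt0 I4 *.
set s1 := trace_sqrt t1 d1 in s1_gt0 I4 *; set s2 := trace_sqrt t2 d2 in s2_gt0 I4 *.
set J := _ + _; move=> [J0 J1].
set w := mixed_det G1 G2 in w_ge w_eq wE.
have {}I4 : 4 * I = J + higgs_form A B (G2 - G1) (G2 - G1) * (s1^-1 + s2^-1)
  + 4 * (w - r1 * r2) * (E2 / (s2 * \det G2) + E1 / (s1 * \det G1)).
  have trE (c2 c1 e2 e1 : R) (N2 N1 M2 M1 H2 H1 : 'M[R]_2) :
    \tr ((c2 *: (N2 - e2 *: M2) - c1 *: (N1 - e1 *: M1)) *m (H2 - H1)) =
    c2 * (\tr (N2 *m H2) - \tr (N2 *m H1) - e2 * (\tr (M2 *m H2) - \tr (M2 *m H1)))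
    - c1 * (\tr (N1 *m H2) - \tr (N1 *m H1)
            - e1 * (\tr (M1 *m H2) - \tr (M1 *m H1))).
    by rewrite !mxtrace2 !mulmx2 !mxE; ring.
  have NE G H : \tr ((A *m G *m A + B *m G *m B) *m H) = higgs_form A B G H.
    by rewrite mulmxDl linearD.
  have adjE G : \tr (adj2 G *m G) = 2 * \det G.
    by rewrite mxtrace2 !mulmx2 /adj2 !mxE mxtrace2 det2 /= ?mulr1n ?mulr0n; ring.
  have wE12 : \tr (adj2 G1 *m G2) = 2 * w.
    by rewrite /w /mixed_det mulrA divff ?mul1r ?pnatr_eq0.
  have wE21 : \tr (adj2 G2 *m G1) = 2 * w.
    rewrite -wE12 !mxtrace2 !mulmx2 /adj2 !mxE !mxtrace2 /= ?mulr1n ?mulr0n.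
    by rewrite G1_10 G2_10; ring.
  have qE : higgs_form A B G2 G1 = higgs_form A B G1 G2.
    by rewrite /higgs_form !mxtrace2 !mulmx2 A10 B10 G1_10 G2_10; ring.
  have hE : higgs_form A B (G2 - G1) (G2 - G1) = t1 + t2 - 2 * higgs_form A B G1 G2.
    rewrite /t1 /t2 /higgs_form !mxtrace2 !mulmx2 !mxE A10 B10 G1_10 G2_10; ring.
  rewrite I4 trE !NE !adjE wE12 wE21 qE hE -/t1 -/t2 /J r1E r2E.
  by field; rewrite !lt0r_neq0.
have c1 : 0 <= s1^-1 + s2^-1 by rewrite addr_ge0// invr_ge0 ltW.
have c2 : 0 < E2 / (s2 * \det G2) + E1 / (s1 * \det G1).
  by apply: addr_gt0; apply: divr_gt0 => //; exact: mulr_gt0.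
have u1 : 0 <= higgs_form A B (G2 - G1) (G2 - G1) * (s1^-1 + s2^-1) by exact: mulr_ge0.
have u2 : 0 <= 4 * (w - r1 * r2) * (E2 / (s2 * \det G2) + E1 / (s1 * \det G1)).
  by apply: mulr_ge0; [lra|exact: ltW].
split; first by lra.
move=> I0; have {J1}rr : r1 = r2.
  by apply/eqP/negP => /negP/J1; lra.
apply: w_eq; first by rewrite r1E r2E rr.
have : 4 * (w - r1 * r2) * (E2 / (s2 * \det G2) + E1 / (s1 * \det G1)) = 0 by lra.
move/eqP; rewrite mulf_eq0 (gt_eqF c2) orbF => /eqP ?.
by rewrite r1E expr2 {2}rr; lra.
Qed.

End PositiveDefinite.

(** * Functional calculus and diagonalization *)

Section FunctionalCalculus.
Context {F : fieldType}.
Implicit Types (P : 'M[F]_2) (d e : 'rV[F]_2).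

Lemma mxtrace_diagonalized P d : P \in unitmx ->
  \tr (invmx P *m diag_mx d *m P) = d 0 0 + d 0 1.
Proof. by move=> uP; rewrite mxtrace_mulC mulmxA mulmxV// mul1mx mxtrace_diag sum_ord2. Qed.

Lemma det_diagonalized P d : P \in unitmx ->
  \det (invmx P *m diag_mx d *m P) = d 0 0 * d 0 1.
Proof.
move=> uP; rewrite !det_mulmx mulrAC -det_mulmx mulVmx// det1 mul1r det_diag.
by rewrite !big_ord_recl big_ord0 mulr1; congr (_ * d _ _); exact: val_inj.
Qed.

(** A function of a diagonalized matrix is determined by its values on the eigenvalues;
    interpolating f(l) l by a + b l on the spectrum gives f(X) X = a + b X. *)
Lemma mulmx_diagonalized P d e (a b : F) : P \in unitmx ->
  (forall j, e 0 j * d 0 j = a + b * d 0 j) ->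
  (invmx P *m diag_mx e *m P) *m (invmx P *m diag_mx d *m P)
  = a%:M + b *: (invmx P *m diag_mx d *m P).
Proof.
move=> uP ed; rewrite !mulmxA mulmxK// -[X in X *m P]mulmxA mulmx_diag.
have -> : diag_mx (\row_j (e 0 j * d 0 j)) = a%:M + b *: diag_mx d.
  by apply/matrixP => i j; rewrite !mxE ed mulrnDl -mulrnAr.
rewrite mulmxDr mulmxDl -scalemxAr -scalemxAl; congr (_ + _).
by rewrite mul_mx_scalar -scalemxAl mulVmx// scalemx1.
Qed.

End FunctionalCalculus.

(** Conjugation by the real matrix Q turns X into N conj(N) with N = Q xi Q^T. Since N is symmetric,
    this is N N^*, which is Hermitian, and the spectral theorem applies. *)
Lemma symmetric_congruence_diag (C : numClosedFieldType) (n : nat) (xi Q : 'M[C]_n) :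
  xi^T = xi -> Q \in unitmx -> map_mx Num.conj Q = Q ->
  exists (P : 'M[C]_n) (d : 'rV[C]_n),
    [/\ P \in unitmx, forall j, d 0 j \is Num.real
      & xi *m (Q^T *m Q) *m map_mx Num.conj xi *m (Q^T *m Q)
        = invmx P *m diag_mx d *m P].
Proof.
move=> xiT uQ Qreal.
pose N := Q *m xi *m Q^T.
pose H := N *m map_mx Num.conj N.
have NT : N^T = N by rewrite /N !trmx_mul trmxK xiT mulmxA.
have symH (M : 'M[C]_n) : M^T = M -> M *m map_mx Num.conj M \is hermsymmx.
  move=> MT; apply/is_hermitianmxP; rewrite expr0 scale1r trmx_mul map_trmx MT.
  by rewrite map_mxM -map_mx_comp (map_mx_id (@conjCK _)).
have HH : H \is hermsymmx by exact: symH.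
have Hspec := orthomx_spectralP (hermitian_normalmx HH).
exists (spectralmx H *m Q), (spectral_diag H); split.
- by rewrite unitmx_mul spectral_unit.
- by move=> j; exact: (mxOverP (hermitian_spectral_diag_real HH)).
- have uS := spectral_unit H.
  transitivity (invmx Q *m H *m Q).
    by rewrite /H /N !map_mxM /= -map_trmx Qreal !mulmxA mulVmx// mul1mx.
  have uSQ : spectralmx H *m Q \in unitmx by rewrite unitmx_mul uS.
  have -> : invmx (spectralmx H *m Q) = invmx Q *m invmx (spectralmx H).
    by rewrite -[RHS](mulmxK uSQ) !mulmxA mulmxKV// mulVmx// mul1mx.
  by rewrite [in LHS]Hspec !mulmxA.
Qed.

(** * The real part of the moment tensor in closed form *)

Section MomentTensor.
Context {R : realType}.
Implicit Types (M N : 'M[R[i]]_2) (A B G : 'M[R]_2).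

Lemma ReM (z w : R[i]) :
  complex.Re (z * w) = complex.Re z * complex.Re w - complex.Im z * complex.Im w.
Proof. by case: z w => [a b] [c d]. Qed.

Lemma ImM (z w : R[i]) :
  complex.Im (z * w) = complex.Re z * complex.Im w + complex.Im z * complex.Re w.
Proof. by case: z w => [a b] [c d]. Qed.

Lemma ReD (z w : R[i]) : complex.Re (z + w) = complex.Re z + complex.Re w.
Proof. by case: z w => [a b] [c d]. Qed.

Lemma ImD (z w : R[i]) : complex.Im (z + w) = complex.Im z + complex.Im w.
Proof. by case: z w => [a b] [c d]. Qed.

Lemma complex_ext (z w : R[i]) :
  complex.Re z = complex.Re w -> complex.Im z = complex.Im w -> z = w.
Proof. by case: z w => [a b] [c d] /= -> ->. Qed.

Lemma re_mxM M N : re_mx (M *m N) = re_mx M *m re_mx N - im_mx M *m im_mx N.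
Proof.
apply/matrixP => i j; rewrite mxE mulmx2 ReD !ReM [RHS]mxE mulmx2 [X in _ = _ + X]mxE mulmx2 !mxE.
by ring.
Qed.

Lemma im_mxM M N : im_mx (M *m N) = re_mx M *m im_mx N + im_mx M *m re_mx N.
Proof.
apply/matrixP => i j; rewrite mxE mulmx2 ImD !ImM [RHS]mxE !mulmx2 !mxE.
by ring.
Qed.

Lemma re_mxD M N : re_mx (M + N) = re_mx M + re_mx N.
Proof. by apply/matrixP => i j; rewrite !mxE ReD. Qed.

Lemma re_mxZ (a : R) M : re_mx (a%:C *: M) = a *: re_mx M.
Proof. by apply/matrixP => i j; rewrite !mxE ReM mul0r subr0. Qed.

Lemma re_mx_real A : re_mx (map_mx (real_complex R) A) = A.
Proof. by apply/matrixP => i j; rewrite !mxE. Qed.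

Lemma im_mx_real A : im_mx (map_mx (real_complex R) A) = 0.
Proof. by apply/matrixP => i j; rewrite !mxE. Qed.

Lemma re_mx_conj M : re_mx (conj_mx M) = re_mx M.
Proof. by apply/matrixP => i j; rewrite !mxE; case: (M i j). Qed.

Lemma im_mx_conj M : im_mx (conj_mx M) = - im_mx M.
Proof. by apply/matrixP => i j; rewrite !mxE; case: (M i j). Qed.

Lemma re_mxT M : (re_mx M)^T = re_mx M^T.
Proof. by rewrite /re_mx map_trmx. Qed.

Lemma im_mxT M : (im_mx M)^T = im_mx M^T.
Proof. by rewrite /im_mx map_trmx. Qed.

Lemma re_mx_higgs M G : let Gc := map_mx (real_complex R) G in
  re_mx (M *m Gc *m conj_mx M) =
  re_mx M *m G *m re_mx M + im_mx M *m G *m im_mx M.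
Proof.
move=> Gc; rewrite re_mxM re_mx_conj im_mx_conj re_mxM im_mxM.
by rewrite re_mx_real im_mx_real !mulmx0 subr0 add0r mulmxN opprK.
Qed.

(** The imaginary part is Tr (B G A G) - Tr (A G B G), which is zero because the trace is cyclic. *)
Lemma mxtrace_higgs M G : let Gc := map_mx (real_complex R) G in
  \tr (M *m Gc *m conj_mx M *m Gc) = (higgs_form (re_mx M) (im_mx M) G G)%:C.
Proof.
move=> Gc.
have trRe N : complex.Re (\tr N) = \tr (re_mx N).
  by rewrite !mxtrace2 !mxE ReD.
have trIm N : complex.Im (\tr N) = \tr (im_mx N).
  by rewrite !mxtrace2 !mxE ImD.
apply: complex_ext.
  rewrite trRe re_mxM re_mx_higgs re_mx_real im_mx_real mulmx0 subr0.
  by rewrite mulmxDl linearD.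
rewrite trIm im_mxM re_mx_real im_mx_real mulmx0 add0r.
rewrite im_mxM re_mx_conj im_mx_conj re_mxM im_mxM re_mx_real im_mx_real.
rewrite !mulmx0 subr0 add0r mulmxN mulmxDl mulNmx linearD linearN /=.
by rewrite -mulmxA mxtrace_mulC mulmxA addNr.
Qed.

Lemma det_norm2_eq0 M : \det M = 0 -> det_norm2 (re_mx M) (im_mx M) = 0.
Proof.
move=> dM; have zz : complex.Re (\det M) ^+ 2 + complex.Im (\det M) ^+ 2 = 0.
  by rewrite dM /= expr0n addr0.
rewrite -[RHS]zz /det_norm2 !det2 !mxE.
move: (M 0 0) (M 0 1) (M 1 0) (M 1 1) => [a a'] [b b'] [c c'] [d d'] /=.
by ring.
Qed.

Lemma det_higgs M G : let Gc := map_mx (real_complex R) G in M^T = M ->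
  \det (M *m Gc *m conj_mx M *m Gc) = (norm_det (re_mx M) (im_mx M) G)%:C.
Proof.
move=> Gc MT; rewrite !det_mulmx /Gc det_map_mx.
have -> : \det (conj_mx M) = Num.conj (\det M) by rewrite /conj_mx det_map_mx.
have zz (z : R[i]) : z * Num.conj z = (complex.Re z ^+ 2 + complex.Im z ^+ 2)%:C.
  case: z => a b; apply: complex_ext.
    by rewrite ReM /=; ring.
  by rewrite ImM /=; ring.
have E : \det M * Num.conj (\det M) = (det_norm2 (re_mx M) (im_mx M))%:C.
  rewrite zz /det_norm2 !det2 !mxE; congr (_ %:C).
  move: (M 0 0) (M 0 1) (M 1 0) (M 1 1) => [a a'] [b b'] [c c'] [d d'] /=.
  by ring.
by rewrite (mulrAC (\det M)) E /norm_det expr2 !rmorphM /= mulrA.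
Qed.

Lemma invmx_real G : \det G != 0 ->
  invmx (map_mx (real_complex R) G) = map_mx (real_complex R) (invmx G).
Proof. by move=> dG; rewrite map_invmx. Qed.

Lemma posdef_cholesky G : posdefmx G -> exists2 Q : 'M[R]_2, Q \in unitmx & G = Q^T *m Q.
Proof.
move=> Gp; have [G10 G00 G11 dG] := posdef_entries _ Gp.
set x := Num.sqrt (G 0 0); have x0 : 0 < x by rewrite sqrtr_gt0.
have xx : G 0 0 = x * x by rewrite -expr2 sqr_sqrtr// ltW.
set D := Num.sqrt (\det G); have D0 : 0 < D by rewrite sqrtr_gt0.
have DD : D * D = G 0 0 * G 1 1 - G 0 1 * G 0 1.
  by rewrite -expr2 sqr_sqrtr ?ltW// det2 G10.
pose Q : 'M[R]_2 := \matrix_(i, j)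
  if i == 0 then (if j == 0 then x else G 0 1 / x) else (if j == 0 then 0 else D / x).
have x0' := lt0r_neq0 x0.
exists Q.
  by rewrite unitmxE unitfE det2 !mxE /= mulr0 subr0 mulf_neq0 ?mulf_neq0 ?invr_eq0 ?lt0r_neq0.
apply: matrix2P; rewrite mulmx2 !mxE /= ?G10.
- by rewrite mulr0 addr0.
- by rewrite mul0r addr0 mulrC divfK.
- by rewrite mulr0 addr0 divfK.
- apply: (mulfI (_ : x * x != 0)); first by rewrite mulf_neq0.
  rewrite -{1}xx (_ : G 0 0 * G 1 1 = D * D + G 0 1 * G 0 1); last by rewrite DD; ring.
  by field.
Qed.

(* psi x * x = (1 - sqrt (1 - x)) / 2, and the square root of the 2x2 matrix
   1 - X is (E - X) / s by Cayley-Hamilton. *)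
Lemma psi_eigenvalues (x y : R) : 0 <= x -> 0 <= y -> x < 1 -> y < 1 ->
  let s := trace_sqrt (x + y) (x * y) in let E := 1 + sqrt_det (x + y) (x * y) in
  psi x * x = (2^-1 - E / (2 * s)) + (2 * s)^-1 * x.
Proof.
move=> x0 y0 x1 y1 s E.
(* These are the eigenvalues of sqrt (1 - X), so E = 1 + a b and s = a + b. *)
set a := Num.sqrt (1 - x); set b := Num.sqrt (1 - y).
have a0 : 0 < a by rewrite sqrtr_gt0 subr_gt0.
have b0 : 0 < b by rewrite sqrtr_gt0 subr_gt0.
have aa : a ^+ 2 = 1 - x by rewrite sqr_sqrtr// subr_ge0 ltW.
have bb : b ^+ 2 = 1 - y by rewrite sqr_sqrtr// subr_ge0 ltW.
have EE : E = 1 + a * b.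
  rewrite /E /sqrt_det; congr (_ + _).
  rewrite [X in Num.sqrt X](_ : _ = (a * b) ^+ 2); last first.
    by rewrite exprMn aa bb; ring.
  by rewrite sqrtr_sqr ger0_norm// ltW// mulr_gt0.
have sE : s = a + b.
  rewrite /s /trace_sqrt -/E EE.
  rewrite [X in Num.sqrt X](_ : _ = (a + b) ^+ 2); last first.
    have -> : x = 1 - a ^+ 2 by rewrite aa; ring.
    have -> : y = 1 - b ^+ 2 by rewrite bb; ring.
    by ring.
  by rewrite sqrtr_sqr ger0_norm// ltW// addr_gt0.
rewrite /psi -/a sE EE.
have -> : x = 1 - a ^+ 2 by rewrite aa; ring.
by field; rewrite !lt0r_neq0// addr_gt0.
Qed.

Lemma sum_prod_unit_interval (x y : R) : 0 <= x + y -> x + y < 1 -> 0 <= x * y ->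
  (0 <= x /\ x < 1) /\ (0 <= y /\ y < 1).
Proof.
move=> s0 s1 p0.
have x0 : 0 <= x by rewrite leNgt; apply/negP => xn; nra.
have y0 : 0 <= y by rewrite leNgt; apply/negP => xn; nra.
by split; split; lra.
Qed.

Lemma moment_tensor_re (xi : 'rV[R]_2 -> 'M[R[i]]_2) (u : 'rV[R]_2 -> R) y :
  (xi y)^T = xi y -> posdefmx (hessian u y) -> higgs_norm2 xi u y < 1 ->
  0 <= higgs_form (re_mx (xi y)) (im_mx (xi y)) (hessian u y) (hessian u y) ->
  higgs_form (re_mx (xi y)) (im_mx (xi y)) (hessian u y) (hessian u y) < 1 /\
  re_mx (moment_tensor xi u y) =
  moment_mx (re_mx (xi y)) (im_mx (xi y)) (hessian u y).
Proof.
rewrite /moment_tensor /alpha_check /higgs_norm2 /xiGxibarG /chessian.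
move: (xi y) (hessian u y) => {u} M G MT Gp; set Gc := map_mx _ G.
have [Q uQ GE] := posdef_cholesky _ Gp.
rewrite mxtrace_higgs (_ : (_ < 1) = (higgs_form (re_mx M) (im_mx M) G G < 1));
  last exact: ltcR.
move=> t1 t0; split=> //.
have AT : (re_mx M)^T = re_mx M by rewrite re_mxT MT.
have BT : (im_mx M)^T = im_mx M by rewrite im_mxT MT.
have [d0 d1] := norm_det_lt _ _ _ AT BT Gp ltac:(by rewrite t0 t1).
have [_ _ _ dG] := posdef_entries _ Gp.
set X := M *m Gc *m conj_mx M *m Gc.
have [Y YE] : exists Y, is_funcalc (@psi R) X Y.
  have [] := symmetric_congruence_diag (R[i]) 2 M (map_mx (real_complex R) Q) MT.
  - by rewrite map_unitmx.
  - by rewrite -map_mx_comp; apply: eq_map_mx => x; exact: conjc_real.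
  move=> P [d [uP dreal XE]].
  pose d' := map_mx (@complex.Re R) d.
  exists (invmx P *m diag_mx (map_mx (fun t => (psi t)%:C) d') *m P), P, d'.
  have dE : map_mx (real_complex R) d' = d.
    by apply/matrixP => i j; rewrite !mxE (ord1 i); exact: RRe_real (dreal j).
  have GcE : (map_mx (real_complex R) Q)^T *m map_mx (real_complex R) Q = Gc.
    by rewrite /Gc GE map_trmx -map_mxM.
  rewrite GcE in XE.
  split; first exact: uP.
    by rewrite dE -XE.
  reflexivity.
(* The value picked by [xget] comes with its own P and d; the trace and determinant of X then give
   the sum and product of these eigenvalues. *)
have [P [d [uP XE ->]]] : is_funcalc (@psi R) X (funcalc (@psi R) X).
  exact: (@xgetPex _ 0 [set Y | is_funcalc (@psi R) X Y] (ex_intro _ Y YE)).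
have tE : d 0 0 + d 0 1 = higgs_form (re_mx M) (im_mx M) G G.
  apply: (@complexI R); rewrite -mxtrace_higgs -/Gc -/X XE.
  by rewrite mxtrace_diagonalized// !mxE rmorphD.
have dE : d 0 0 * d 0 1 = norm_det (re_mx M) (im_mx M) G.
  apply: (@complexI R); rewrite -det_higgs// -/Gc -/X XE.
  by rewrite det_diagonalized// !mxE rmorphM.
have [[x0 x1] [y0 y1]] : (0 <= d 0 0 /\ d 0 0 < 1) /\ (0 <= d 0 1 /\ d 0 1 < 1).
  by apply: sum_prod_unit_interval; rewrite ?tE ?dE.
have psi0 := psi_eigenvalues _ _ x0 y0 x1 y1; rewrite /= tE dE in psi0.
have psi1 := psi_eigenvalues _ _ y0 x0 y1 x1.
rewrite /= [d 0 1 + _]addrC [d 0 1 * d 0 0]mulrC tE dE in psi1.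
rewrite /moment_mx.
move: (trace_sqrt _ _) (1 + sqrt_det _ _) psi0 psi1 => s E psi0 psi1.
have uG : \det Gc != 0 by rewrite det_map_mx fmorph_eq0 lt0r_neq0.
have YX := mulmx_diagonalized P (map_mx (real_complex R) d)
  (map_mx (fun t => (psi t)%:C) d) (2^-1 - E / (2 * s))%:C ((2 * s)^-1)%:C uP.
rewrite -XE in YX.
set Y' := invmx P *m _ *m P in YX *.
have uGc : Gc \in unitmx by rewrite unitmxE unitfE.
(* This makes psi(X) X appear, which is affine in X; the summand 1/2 of its constant term cancels
   the term - G^-1 / 2 of the moment tensor. *)
have -> : Y' *m M *m Gc *m conj_mx M = Y' *m X *m invmx Gc.
  by rewrite /X !mulmxA mulmxK.
rewrite YX; last first.
  move=> j; rewrite !mxE -!rmorphM -rmorphD; congr (_%:C).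
  case: j => [[|[|k]] kP] //.
    by rewrite (_ : Ordinal kP = 0) ?psi0 //; exact: val_inj.
  by rewrite (_ : Ordinal kP = 1) ?psi1 //; exact: val_inj.
rewrite mulmxDl mul_scalar_mx -scalemxAl /X mulmxK// invmx_real ?lt0r_neq0//.
have half : (2^-1 : R[i]) = (2^-1 : R)%:C by rewrite fmorphV rmorph_nat.
rewrite -scaleNr half -rmorphN addrA -scalerDl -rmorphD /=.
rewrite re_mxD !re_mxZ re_mx_real re_mx_higgs invmx2 ?lt0r_neq0//.
rewrite !scalerBr !scalerA addrC; congr (_ + _).
rewrite -scalerBr -[in RHS]scalerBr -scaleNr; congr (_ *: _).
by rewrite invfM; ring.
Qed.

End MomentTensor.

(** * Functions of class C^k on the plane *)

Section PartialDerivatives.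
Context {R : realType}.
Local Notation V := 'rV[R]_2.
Implicit Types (f g : V -> R) (y : V) (a b : 'I_2) (k : nat).

(** With a finite order of regularity, closure under products, inverses and square roots is an
    induction on k. *)
Fixpoint Ck k f : Prop :=
  continuous f /\ if k is k'.+1 then forall a,
    (forall y, derivable f y (delta_mx 0 a)) /\ Ck k' (partial a f) else True.

Lemma Ck_continuous k f : Ck k f -> continuous f.
Proof. by case: k => [|k] []. Qed.

Lemma Ck_partial k f a : Ck k.+1 f -> Ck k (partial a f).
Proof. by case=> _ /(_ a)[]. Qed.

Lemma Ck_is_derive k f a y : Ck k.+1 f ->
  is_derive y (delta_mx 0 a) f (partial a f y).
Proof. by case=> _ /(_ a)[fd _]; exact: DeriveDef. Qed.

Lemma Ck_pred k f : Ck k.+1 f -> Ck k f.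
Proof.
elim: k f => [|k IH] f [fc fd]; split=> // a.
by case: (fd a) => fda /IH.
Qed.

Lemma Ck_intro k f (df : 'I_2 -> V -> R) : continuous f ->
  (forall a y, is_derive y (delta_mx 0 a) f (df a y)) ->
  (forall a, Ck k (df a)) -> Ck k.+1 f.
Proof.
move=> fc fd dfk; split=> // a; split; first by move=> y; case: (fd a y).
have -> : partial a f = df a.
  by apply/funext => y; exact: (@derive_val _ _ _ _ _ _ _ (fd a y)).
exact: dfk.
Qed.

Lemma smooth_Ck k f : smooth f -> Ck k f.
Proof.
elim: k f => [|k IH] f fs; first by split=> //; exact: (fs [::]).1.
split; first exact: (fs [::]).1.
move=> a; split; first exact: (fs [::]).2.
(* [foldr] applies the last index of the list first, hence [rcons]. *)
apply: IH => s; have := fs (rcons s a).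
by rewrite foldr_rcons.
Qed.

Lemma Ck_const k (c : R) : Ck k (fun=> c).
Proof.
elim: k c => [|k IH] c; first by split=> //; exact: cst_continuous.
apply: (Ck_intro _ _ (fun _ _ => 0)); first by exact: cst_continuous.
move=> a; exact: (IH 0).
Qed.

Lemma Ck_add k f g : Ck k f -> Ck k g -> Ck k (fun y => f y + g y).
Proof.
elim: k f g => [|k IH] f g fk gk.
  split=> // y; apply: continuousD; [exact: (Ck_continuous _ _ fk)|exact: (Ck_continuous _ _ gk)].
apply: (Ck_intro _ _ (fun a y => partial a f y + partial a g y)).
- move=> y; apply: continuousD; [exact: (Ck_continuous _ _ fk)|exact: (Ck_continuous _ _ gk)].
- by move=> a y; apply: is_derive_add; exact: (Ck_is_derive k).
- by move=> a; apply: IH; exact: Ck_partial.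
Qed.

Lemma Ck_mul k f g : Ck k f -> Ck k g -> Ck k (fun y => f y * g y).
Proof.
elim: k f g => [|k IH] f g fk gk.
  split=> // y; apply: continuousM; [exact: (Ck_continuous _ _ fk)|exact: (Ck_continuous _ _ gk)].
apply: (Ck_intro _ _ (fun a y => partial a f y * g y + f y * partial a g y)).
- move=> y; apply: continuousM; [exact: (Ck_continuous _ _ fk)|exact: (Ck_continuous _ _ gk)].
- by move=> a y; apply: is_derive_mul; exact: (Ck_is_derive k).
- by move=> a; apply: Ck_add; apply: IH => //; exact: Ck_partial || exact: Ck_pred.
Qed.

Lemma Ck_opp k f : Ck k f -> Ck k (fun y => - f y).
Proof.
move=> fk; rewrite (_ : (fun y => - f y) = (fun y => -1 * f y)).
  by apply: Ck_mul => //; exact: Ck_const.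
by apply/funext => y; rewrite mulN1r.
Qed.

Lemma Ck_sub k f g : Ck k f -> Ck k g -> Ck k (fun y => f y - g y).
Proof. by move=> fk gk; apply: Ck_add => //; exact: Ck_opp. Qed.

Lemma Ck_inv k f : (forall y, f y != 0) -> Ck k f -> Ck k (fun y => (f y)^-1).
Proof.
move=> f0; elim: k f f0 => [|k IH] f f0 fk.
  by split=> // y; apply: continuousV => //; exact: (Ck_continuous _ _ fk).
apply: (Ck_intro _ _ (fun a y => - (partial a f y * ((f y)^-1 * (f y)^-1)))).
- by move=> y; apply: continuousV => //; exact: (Ck_continuous _ _ fk).
- by move=> a y; apply: is_derive_inv => //; exact: (Ck_is_derive k).
- move=> a; apply/Ck_opp/Ck_mul; first exact: Ck_partial.
  by apply: Ck_mul; apply: IH => //; exact: Ck_pred.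
Qed.

Lemma Ck_sqrt k f : (forall y, 0 < f y) -> Ck k f -> Ck k (fun y => Num.sqrt (f y)).
Proof.
move=> f0; elim: k f f0 => [|k IH] f f0 fk.
  split=> // y; apply: continuous_comp; first exact: (Ck_continuous _ _ fk).
  exact: sqrt_continuous.
apply: (Ck_intro _ _ (fun a y => partial a f y * (2 * Num.sqrt (f y))^-1)).
- move=> y; apply: continuous_comp; first exact: (Ck_continuous _ _ fk).
  exact: sqrt_continuous.
- by move=> a y; apply: is_derive_sqrt => //; exact: (Ck_is_derive k).
- move=> a; apply: Ck_mul; first exact: Ck_partial.
  apply: Ck_inv; first by move=> y; rewrite mulf_neq0 ?pnatr_eq0// gt_eqF// sqrtr_gt0.
  by apply: Ck_mul; [exact: Ck_const|apply: IH => //; exact: Ck_pred].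
Qed.

Lemma is_derive_coord a b y :
  is_derive y (delta_mx 0 b) (fun z : V => z 0 a) ((a == b)%:R : R).
Proof.
apply/is_derive_line.
rewrite (_ : (fun h : R => _) = (fun h : R => h * (a == b)%:R + y 0 a)).
  have := is_derive_add _ _ _ _ _ _
   (is_derive_mul _ _ _ _ _ _ (is_derive_id (0 : R) (1 : R))
      (is_derive_const (0 : R) (1 : R) ((a == b)%:R : R)))
   (is_derive_const (0 : R) (1 : R) (y 0 a)).
  by move/is_derive_eq; apply; rewrite mul1r mulr0 !addr0.
by apply/funext => h; rewrite !mxE eqxx /= eq_sym.
Qed.

Lemma Ck_coord k a : Ck k (fun y : V => y 0 a).
Proof.
case: k => [|k]; first by split=> //; exact: coord_continuous.
apply: (Ck_intro _ _ (fun b y => (a == b)%:R)); first exact: coord_continuous.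
  by move=> b y; exact: is_derive_coord.
by move=> b; exact: Ck_const.
Qed.

Lemma partial_add k f g a : Ck k.+1 f -> Ck k.+1 g ->
  partial a (fun y => f y + g y) = fun y => partial a f y + partial a g y.
Proof.
move=> fk gk; apply/funext => y; apply: derive_val.
by apply: is_derive_add; exact: (Ck_is_derive k).
Qed.

Lemma partial_sub k f g a : Ck k.+1 f -> Ck k.+1 g ->
  partial a (fun y => f y - g y) = fun y => partial a f y - partial a g y.
Proof.
move=> fk gk; apply/funext => y; apply: derive_val.
by apply: is_derive_sub; exact: (Ck_is_derive k).
Qed.

Lemma periodic_partial f a : Defs.periodic f -> Defs.periodic (partial a f).
Proof.
move=> fp y k; rewrite /partial /derive; congr (lim _).
rewrite (_ : (fun h : R => _) =
  (fun h : R => h^-1 *: ((f \o shift y) (h *: delta_mx 0 a) - f y)))//.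
by apply/funext => h /=; rewrite addrA !fp.
Qed.

End PartialDerivatives.

(** * Nonnegative periodic divergences vanish *)

Section DivergenceTheorem.
Local Open Scope ring_scope.
Local Open Scope classical_set_scope.
Context {R : realType}.
Local Notation V := 'rV[R]_2.
Local Notation mu := (@lebesgue_measure R).
Implicit Types (f : V -> R) (g : R -> R) (x s : R) (y : V).

Lemma rV2_eta y : y = rV2 (y 0 0) (y 0 1).
Proof.
apply/matrixP => i j; rewrite !mxE (ord1 i); case: j => [[|[|k]] kP] //=;
  by congr (y _ _); exact: val_inj.
Qed.

Lemma is_derive_fst k f x s : Ck k.+1 f ->
  is_derive x 1 (fun z => f (rV2 z s)) (partial 0 f (rV2 x s)).
Proof.
move=> fk; have /is_derive_line := Ck_is_derive k f 0 (rV2 x s) fk.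
move=> fd; apply/is_derive_line; move: fd.
rewrite (_ : (fun h : R => f (h *: delta_mx 0 0 + rV2 x s)) =
  (fun h : R => f (rV2 (h *: 1 + x) s)))//.
apply/funext => h; congr f; apply/matrixP => i j; rewrite !mxE (ord1 i) /=.
by case: j => [[|[|j]] jP] //=; rewrite ?mulr1 ?mulr0 ?add0r.
Qed.

Lemma is_derive_snd k f x s : Ck k.+1 f ->
  is_derive s 1 (fun z => f (rV2 x z)) (partial 1 f (rV2 x s)).
Proof.
move=> fk; have /is_derive_line := Ck_is_derive k f 1 (rV2 x s) fk.
move=> fd; apply/is_derive_line; move: fd.
rewrite (_ : (fun h : R => f (h *: delta_mx 0 1 + rV2 x s)) =
  (fun h : R => f (rV2 x (h *: 1 + s))))//.
apply/funext => h; congr f; apply/matrixP => i j; rewrite !mxE (ord1 i) /=.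
by case: j => [[|[|j]] jP] //=; rewrite ?mulr1 ?mulr0 ?add0r.
Qed.

Lemma continuous_fst f s : continuous f -> continuous (fun x => f (rV2 x s)).
Proof.
move=> fc x; apply: (@continuous_comp _ _ _ (fun x => rV2 x s) f); last exact: fc.
rewrite (_ : (fun x => rV2 x s) = (fun x => x *: (delta_mx 0 0 : V) + rV2 0 s)).
  by apply: continuousD; [exact: scalel_continuous|exact: cst_continuous].
apply/funext => h; apply/matrixP => i j; rewrite !mxE (ord1 i) /=.
by case: j => [[|[|j]] jP] //=; rewrite ?mulr1 ?mulr0 ?addr0 ?add0r.
Qed.

Lemma periodic_fst f x s : Defs.periodic f -> f (rV2 (x + 1) s) = f (rV2 x s).
Proof.
move=> fp; rewrite -[RHS](fp _ (\row_j (j == 0)%:Z)); congr f.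
apply/matrixP => i j; rewrite !mxE /=.
by case: j => [[|[|j]] jP] //=; rewrite ?addr0.
Qed.

Lemma periodic_snd f x s (n : nat) :
  Defs.periodic f -> f (rV2 x (s + n%:R)) = f (rV2 x s).
Proof.
move=> fp; rewrite -[RHS](fp _ (\row_j if j == 0 then 0 else n%:Z)); congr f.
apply/matrixP => i j; rewrite !mxE /=.
by case: j => [[|[|j]] jP] //=; rewrite ?addr0.
Qed.

Lemma periodic_bounded f : continuous f -> Defs.periodic f ->
  exists M, forall y, `|f y| <= M.
Proof.
move=> fc fp.
pose K := [set v : V | forall i, `[0, 1] (v ord0 i : R)].
have Kc : compact K.
  exact: (@rV_compact R 2 (fun=> `[0, 1]) (fun=> @segment_compact R 0 1)).
have fKc : {within K, continuous f} by exact: continuous_subspaceT.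
have [M [_ /(_ (M + 1)) HM]] := compact_bounded (continuous_compact fKc Kc).
(* Boundedness is available for every number strictly above [M], hence [M + 1]; the floors translate
   [y] into the unit square. *)
exists (M + 1) => y.
pose k : 'rV[int]_2 := \row_j - Num.floor (y 0 j).
rewrite -(fp y k); apply: HM; first by rewrite ltrDl.
exists (y + map_mx intr k) => // i /=; rewrite !mxE in_itv /= rmorphN /=.
have := floor_itv (y ord0 i); rewrite intrD => /andP[h1 h2].
by rewrite subr_ge0 lerBlDl h1 ltW.
Qed.

Lemma continuous_integrable g a b : continuous g ->
  mu.-integrable `[a, b] (EFin \o g).
Proof.
move=> gc; apply: continuous_compact_integrable; first exact: segment_compact.
exact: continuous_subspaceT.
Qed.

Lemma Rintegral_derivative (G g : R -> R) (a b : R) : a < b ->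
  (forall x, is_derive x 1 G (g x)) -> continuous g ->
  \int[mu]_(x in `[a, b]) g x = G b - G a.
Proof.
move=> ab Gd gc.
have Gc : continuous G.
  by move=> x; apply: differentiable_continuous; apply/derivable1_diffP; case: (Gd x).
rewrite /Rintegral (@continuous_FTC2 _ g G a b ab).
- by rewrite -EFinB.
- exact: continuous_subspaceT.
- split.
  + by move=> x _; case: (Gd x).
  + by apply: cvg_at_right_filter; exact: Gc.
  + by apply: cvg_at_left_filter; exact: Gc.
- by move=> x _; rewrite derive1E; apply: derive_val.
Qed.

(** The integrals over [a, z] lie between 0 and the full integral, so they vanish, and [g x] is the
    derivative of this zero function. *)
Lemma Rintegral_eq0_continuous g (a b x : R) : continuous g ->
  (forall z, 0 <= g z) -> \int[mu]_(z in `[a, b]) g z = 0 -> a < x < b -> g x = 0.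
Proof.
move=> gc g0 gI /andP[ax xb].
have Pz z : a < z < b -> \int[mu]_(t in `[a, z]) g t = 0.
  move=> /andP[az zb]; apply/le_anti/andP; split; last exact: Rintegral_ge0.
  rewrite -gI -subr_ge0 (@Rintegral_itvB _ g (BLeft a) (BRight b) z).
  - exact: Rintegral_ge0.
  - exact: continuous_integrable.
  - by rewrite bnd_simp ltW.
  - by rewrite bnd_simp ltW.
have [_ <-] := @continuous_FTC1_closed _ g a x b xb (continuous_integrable g a b gc) ax (gc x).
rewrite derive1E.
rewrite (@near_eq_derive _ _ _ _ (cst 0)) ?derive_cst//.
have xab : x \in `]a, b[%R by rewrite in_itv /= ax xb.
apply: filterS (near_in_itvoo xab) => z; rewrite in_itv /=; exact: Pz.
Qed.

(** Slicing reduces the problem to one-dimensional integrals. The mean [F] of [W1] over a period of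
    the first coordinate has as derivative the integral of the divergence, since [partial 0 W0]
    integrates to zero over a period. Being nondecreasing and periodic, [F] is constant. *)
Lemma periodic_divergence_ge0 (W0 W1 : V -> R) :
  Ck 1 W0 -> Ck 1 W1 -> Defs.periodic W0 -> Defs.periodic W1 ->
  (forall y, 0 <= partial 0 W0 y + partial 1 W1 y) ->
  forall y, partial 0 W0 y + partial 1 W1 y = 0.
Proof.
move=> W0k W1k W0p W1p I0 y.
(* The period is centred at the given point, which is thus interior to the interval of
   integration. *)
set a := y 0 0 - 2^-1.
pose F s := \int[mu]_(x in `[a, a + 1]) W1 (rV2 x s).
have c1 s : continuous (fun x => partial 1 W1 (rV2 x s)).
  by apply: continuous_fst; exact/Ck_continuous/Ck_partial/W1k.
have c0 s : continuous (fun x => partial 0 W0 (rV2 x s)).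
  by apply: continuous_fst; exact/Ck_continuous/Ck_partial/W0k.
have aa1 : a < a + 1 by rewrite ltrDl.
(* The constant [M] is the dominating function for differentiation under the integral. *)
have [M MP] := periodic_bounded _ (Ck_continuous _ _ (Ck_partial _ _ 1 W1k))
  (periodic_partial _ 1 W1p).
have d2E s x : partial1of2 (fun s x => W1 (rV2 x s)) s x = partial 1 W1 (rV2 x s).
  by rewrite partial1of2E; apply: derive_val; exact: (is_derive_snd 0).
have mB : measurable (`[a, a + 1] : set (measurableTypeR R)) by exact: measurable_itv.
have dF s : is_derive s 1 F
  (\int[mu]_(x in `[a, a + 1]) (partial 0 W0 (rV2 x s) + partial 1 W1 (rV2 x s))).
  have sI : `]s - 1, s + 1[ s by rewrite /= in_itv /=; apply/andP; split; lra.
  have H1 s' : `]s - 1, s + 1[ s' -> mu.-integrable `[a, a + 1] (EFin \o (fun x => W1 (rV2 x s'))).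
    by move=> _; apply: continuous_integrable; apply: continuous_fst; exact: Ck_continuous W1k.
  have H2 s' x : `]s - 1, s + 1[ s' -> `[a, a + 1] x -> derivable (fun s => W1 (rV2 x s)) s' 1.
    by move=> _ _; case: (is_derive_snd 0 W1 x s' W1k).
  have G0 (x : R) : 0 <= (fun=> M) x by apply: le_trans (MP 0); exact: normr_ge0.
  have H3 : mu.-integrable `[a, a + 1] (EFin \o (fun=> M)).
    by apply: continuous_integrable; exact: cst_continuous.
  have H4 s' x : `]s - 1, s + 1[ s' -> `[a, a + 1] x ->
      `|partial1of2 (fun s x => W1 (rV2 x s)) s' x| <= (fun=> M) x.
    by move=> _ _; rewrite d2E.
  have D1 := @derivable_under_integral R _ (measurableTypeR R) mu
    (fun s x => W1 (rV2 x s)) _ mB _ _ _ sI H1 H2 (fun=> M) G0 H3 H4.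
  have D2 := @differentiation_under_integral R _ (measurableTypeR R) mu
    (fun s x => W1 (rV2 x s)) _ mB _ _ _ sI H1 H2 (fun=> M) G0 H3 H4.
  split; first exact: D1.
  rewrite -derive1E D2 (RintegralD mB (continuous_integrable _ a (a + 1) (c0 s))
    (continuous_integrable _ a (a + 1) (c1 s))).
  rewrite (@Rintegral_derivative (fun x => W0 (rV2 x s)) _ a (a + 1) aa1 _ (c0 s)).
    by rewrite periodic_fst// subrr add0r; apply: eq_Rintegral => x _; rewrite d2E.
  by move=> x; exact: (is_derive_fst 0).
have Fc : continuous F.
  by move=> s; apply: differentiable_continuous; apply/derivable1_diffP; case: (dF s).
have Fmono s1 s2 : s1 <= s2 -> F s1 <= F s2.
  move=> s12; have [c _] := MVT_segment s12 (fun s _ => dF s) (continuous_subspaceT Fc).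
  rewrite -subr_ge0 => ->; apply: mulr_ge0; last by rewrite subr_ge0.
  by apply: Rintegral_ge0 => x _; exact: I0.
have Fper s (n : nat) : F (s + n%:R) = F s.
  by apply: eq_Rintegral => x _; exact: periodic_snd.
have Fle s1 s2 : F s1 <= F s2.
  have [s12|/ltW s21] := leP s1 s2; first exact: Fmono.
  (* Enough whole periods are added to [s2] to pass [s1]. *)
  rewrite -(Fper s2 (Num.truncn (s1 - s2)).+1); apply: Fmono.
  by rewrite -lerBlDl; apply/ltW/truncnS_gt.
have Fcst : F = cst (F 0) by apply/funext => s; apply/le_anti; rewrite !Fle.
have := @derive_val _ _ _ _ _ _ _ (dF (y 0 1)); rewrite Fcst derive_cst => /esym I_eq0.
rewrite [y]rV2_eta.
apply: (Rintegral_eq0_continuous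
  (fun x => partial 0 W0 (rV2 x (y 0 1)) + partial 1 W1 (rV2 x (y 0 1)))
  a (a + 1) (y 0 0)).
- by move=> x; exact: (continuousD (c0 (y 0 1) x) (c1 (y 0 1) x)).
- by move=> x; exact: I0.
- exact: I_eq0.
- by rewrite /a; apply/andP; split; lra.
Qed.

End DivergenceTheorem.

(** * Regularity of the moment matrix, and periodic functions with zero Hessian *)

Section MomentSmoothness.
Context {R : realType}.
Local Notation V := 'rV[R]_2.
Implicit Types (f u v w : V -> R) (A B G M N : V -> 'M[R]_2) (k : nat).

Definition Ck_mx k M := forall i j, Ck k (fun y => M y i j).

Lemma Ck_mulmx k M N : Ck_mx k M -> Ck_mx k N -> Ck_mx k (fun y => M y *m N y).
Proof.
move=> Mk Nk i j; rewrite (_ : (fun y => _) =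
  (fun y => M y i 0 * N y 0 j + M y i 1 * N y 1 j)).
  by apply: Ck_add; apply: Ck_mul.
by apply/funext => y; rewrite mulmx2.
Qed.

Lemma Ck_addmx k M N : Ck_mx k M -> Ck_mx k N -> Ck_mx k (fun y => M y + N y).
Proof.
move=> Mk Nk i j; rewrite (_ : (fun y => _) = (fun y => M y i j + N y i j)).
  exact: Ck_add.
by apply/funext => y; rewrite mxE.
Qed.

Lemma Ck_scalemx k f M : Ck k f -> Ck_mx k M -> Ck_mx k (fun y => f y *: M y).
Proof.
move=> fk Mk i j; rewrite (_ : (fun y => _) = (fun y => f y * M y i j)).
  exact: Ck_mul.
by apply/funext => y; rewrite mxE.
Qed.

Lemma Ck_submx k M N : Ck_mx k M -> Ck_mx k N -> Ck_mx k (fun y => M y - N y).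
Proof.
move=> Mk Nk i j; rewrite (_ : (fun y => _) = (fun y => M y i j - N y i j)).
  exact: Ck_sub.
by apply/funext => y; rewrite !mxE.
Qed.

Lemma Ck_mxtrace k M : Ck_mx k M -> Ck k (fun y => \tr (M y)).
Proof.
move=> Mk; rewrite (_ : (fun y => _) = (fun y => M y 0 0 + M y 1 1)).
  exact: Ck_add.
by apply/funext => y; rewrite mxtrace2.
Qed.

Lemma Ck_det k M : Ck_mx k M -> Ck k (fun y => \det (M y)).
Proof.
move=> Mk; rewrite (_ : (fun y => _) = (fun y => M y 0 0 * M y 1 1 - M y 0 1 * M y 1 0)).
  by apply: Ck_sub; exact: Ck_mul.
by apply/funext => y; rewrite det2.
Qed.

Lemma Ck_adj2 k M : Ck_mx k M -> Ck_mx k (fun y => adj2 (M y)).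
Proof.
move=> Mk; apply: Ck_submx => // i j.
rewrite (_ : (fun y => _) = (fun y => \tr (M y) * (i == j)%:R)).
  by apply: Ck_mul; [exact: Ck_mxtrace|exact: Ck_const].
by apply/funext => y; rewrite mxE mulr_natr.
Qed.

Lemma Ck_moment_mx k A B G :
  Ck_mx k A -> Ck_mx k B -> Ck_mx k G ->
  (forall y, 0 < \det (G y)) ->
  (forall y, higgs_form (A y) (B y) (G y) (G y) < 1) ->
  (forall y, 0 <= norm_det (A y) (B y) (G y)) ->
  (forall y, 4 * norm_det (A y) (B y) (G y) < 1) ->
  Ck_mx k (fun y => moment_mx (A y) (B y) (G y)).
Proof.
move=> Ak Bk Gk dG t1 d0 d1; rewrite /moment_mx.
have tk : Ck k (fun y => higgs_form (A y) (B y) (G y) (G y)).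
  by rewrite /higgs_form; apply: Ck_add; apply: Ck_mxtrace; do ![apply: Ck_mulmx].
have dk : Ck k (fun y => norm_det (A y) (B y) (G y)).
  rewrite /norm_det /det_norm2; apply: Ck_mul.
    apply: Ck_add; apply: Ck_mul.
    - by apply: Ck_sub; exact: Ck_det.
    - by apply: Ck_sub; exact: Ck_det.
    - by apply: Ck_sub; [apply: Ck_sub; [apply: Ck_add|]|]; apply: Ck_mul.
    - by apply: Ck_sub; [apply: Ck_sub; [apply: Ck_add|]|]; apply: Ck_mul.
  by apply: Ck_mul; exact: Ck_det.
have Ek : Ck k (fun y => 1 + sqrt_det (higgs_form (A y) (B y) (G y) (G y))
                               (norm_det (A y) (B y) (G y))).
  apply: Ck_add; first exact: Ck_const.
  apply: Ck_sqrt; first by move=> y; have := t1 y; have := d0 y; lra.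
  by apply: Ck_add => //; apply: Ck_sub => //; exact: Ck_const.
apply: Ck_scalemx.
  apply: Ck_inv.
    move=> y; rewrite mulf_neq0 ?pnatr_eq0// gt_eqF// sqrtr_gt0.
    exact: trace_sqrt_gt0.
  apply: Ck_mul; first exact: Ck_const.
  apply: Ck_sqrt; first by move=> y; exact: trace_sqrt_gt0.
  by apply: Ck_sub => //; exact: Ck_mul.
apply: Ck_submx; first by apply: Ck_addmx; do ![apply: Ck_mulmx].
apply: Ck_scalemx; last exact: Ck_adj2.
apply: Ck_mul => //; apply: Ck_inv; last exact: Ck_det.
by move=> y; rewrite gt_eqF.
Qed.

Lemma constant_of_partial0 f : Ck 1 f -> (forall a y, partial a f y = 0) ->
  forall y z, f y = f z.
Proof.
move=> fk f0 y z; rewrite (rV2_eta y) (rV2_eta z).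
transitivity (f (rV2 (z 0 0) (y 0 1))).
  apply: (@is_derive_0_is_cst _ (fun x => f (rV2 x (y 0 1)))) => x.
  by rewrite -(f0 0 (rV2 x (y 0 1))); exact: (is_derive_fst 0).
apply: (@is_derive_0_is_cst _ (fun x => f (rV2 (z 0 0) x))) => x.
by rewrite -(f0 1 (rV2 (z 0 0) x)); exact: (is_derive_snd 0).
Qed.

(** Each first derivative is constant, and by the mean value theorem over one period it vanishes
    somewhere. *)
Lemma periodic_hessian0_constant f : Ck 2 f -> Defs.periodic f ->
  (forall a b y, partial b (partial a f) y = 0) -> forall y z, f y = f z.
Proof.
move=> fk fp f0; have fk1 := Ck_pred _ _ fk.
have fac a : forall y z, partial a f y = partial a f z.
  by apply: constant_of_partial0 => //; exact: Ck_partial.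
have derivable_continuous (g : R -> R) (dg : R -> R) :
    (forall x : R, is_derive x 1 g (dg x)) -> continuous g.
  move=> gd x; apply: differentiable_continuous; apply/derivable1_diffP.
  by case: (gd x).
apply: constant_of_partial0 => // a y.
have [-> | ->] : a = 0 \/ a = 1.
  by case: a => [[|[|j]] jP] //; [left|right]; exact: val_inj.
- have d x := is_derive_fst 0 f x 0 fk1.
  have [c _] := MVT_segment ler01 (fun x _ => d x)
    (continuous_subspaceT (derivable_continuous _ _ d)).
  have := periodic_fst f 0 0 fp; rewrite add0r => ->.
  by rewrite subrr subr0 mulr1 => ->; exact: fac.
- have d x := is_derive_snd 0 f 0 x fk1.
  have [c _] := MVT_segment ler01 (fun x _ => d x)
    (continuous_subspaceT (derivable_continuous _ _ d)).
  have := periodic_snd f 0 0 1 fp; rewrite add0r => ->.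
  by rewrite subrr subr0 mulr1 => ->; exact: fac.
Qed.

End MomentSmoothness.

(** * Symplectic potentials and integration by parts *)

Section Potentials.
Context {R : realType}.
Local Notation V := 'rV[R]_2.
Implicit Types (u v w phi : V -> R) (q : V -> 'M[R]_2) (y : V) (a b : 'I_2) (k : nat).

Lemma Ck_half_norm2 k : Ck k (fun y : V => 2^-1 * (y 0 0 * y 0 0 + y 0 1 * y 0 1)).
Proof.
apply: Ck_mul; first exact: Ck_const.
by apply: Ck_add; apply: Ck_mul; exact: Ck_coord.
Qed.

Lemma partial_half_norm2 a :
  partial a (fun y : V => 2^-1 * (y 0 0 * y 0 0 + y 0 1 * y 0 1)) = fun y => y 0 a.
Proof.
apply/funext => y; apply: derive_val.
have := is_derive_mul _ _ _ _ _ _ (is_derive_const y (delta_mx 0 a) (2^-1 : R))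
  (is_derive_add _ _ _ _ _ _
    (is_derive_mul _ _ _ _ _ _ (is_derive_coord 0 a y) (is_derive_coord 0 a y))
    (is_derive_mul _ _ _ _ _ _ (is_derive_coord 1 a y) (is_derive_coord 1 a y))).
move/is_derive_eq; apply.
have [-> | ->] : a = 0 \/ a = 1.
  by case: a => [[|[|j]] jP] //; [left|right]; exact: val_inj.
all: by rewrite /=; field.
Qed.

Lemma partial_coord a b : partial b (fun y : V => y 0 a) = fun=> (a == b)%:R.
Proof. by apply/funext => y; apply: derive_val; exact: is_derive_coord. Qed.

Lemma potential_decomposition u : symplectic_potential u -> exists v,
  [/\ smooth v, Defs.periodic v &
      u = fun y => 2^-1 * (y 0 0 * y 0 0 + y 0 1 * y 0 1) + v y].
Proof.
case=> [[v [vs vp uE]] _]; exists v; split=> //.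
by apply/funext => y; rewrite uE sum_ord2 !expr2.
Qed.

Lemma Ck_potential k u : symplectic_potential u -> Ck k u.
Proof.
move=> /potential_decomposition[v [vs _ ->]].
by apply: Ck_add; [exact: Ck_half_norm2|exact: smooth_Ck].
Qed.

Lemma sum_partial2_sub (f g : 'I_2 -> 'I_2 -> V -> R) y :
  (forall a b, Ck 2 (f a b)) -> (forall a b, Ck 2 (g a b)) ->
  \sum_(a < 2) \sum_(b < 2) partial b (partial a (f a b)) y = 0 ->
  \sum_(a < 2) \sum_(b < 2) partial b (partial a (g a b)) y = 0 ->
  \sum_(a < 2) \sum_(b < 2) partial b (partial a (fun z => f a b z - g a b z)) y = 0.
Proof.
move=> fk gk ef eg.
transitivity (\sum_(a < 2) \sum_(b < 2) partial b (partial a (f a b)) y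
  - \sum_(a < 2) \sum_(b < 2) partial b (partial a (g a b)) y);
  last by rewrite [X in X - _]ef [X in _ - X]eg subrr.
rewrite -sumrB.
apply: eq_bigr => a _; rewrite -sumrB; apply: eq_bigr => b _.
rewrite (partial_sub 1 _ _ a (fk a b) (gk a b)).
by rewrite (partial_sub 0 _ _ b (Ck_partial _ _ a (fk a b)) (Ck_partial _ _ a (gk a b))).
Qed.

Lemma re_mxE (M : 'M[R[i]]_2) a b : re_mx M a b = complex.Re (M a b).
Proof. by rewrite mxE. Qed.

Lemma Re_sum4 (x0 x1 x2 x3 : R[i]) : complex.Re (x0 + x1 + (x2 + x3)) =
  complex.Re x0 + complex.Re x1 + (complex.Re x2 + complex.Re x3).
Proof. by rewrite (ReD (x0 + x1)) (ReD x0) (ReD x2). Qed.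

Lemma re_cpartial2 a b (f : V -> R[i]) y :
  complex.Re (cpartial b (cpartial a f) y) =
  partial b (partial a (fun z => complex.Re (f z))) y.
Proof. by []. Qed.

Lemma re_cpartial2_sum (f : 'I_2 -> 'I_2 -> V -> R[i]) y :
  \sum_(a < 2) \sum_(b < 2) cpartial b (cpartial a (f a b)) y = 0 ->
  \sum_(a < 2) \sum_(b < 2) partial b (partial a (fun z => complex.Re (f a b z))) y = 0.
Proof.
rewrite (sum_sum_ord2 (fun a b => partial b (partial a (fun z => complex.Re (f a b z))) y)).
rewrite (sum_sum_ord2 (fun a b => cpartial b (cpartial a (f a b)) y)).
by move=> e; rewrite -4!re_cpartial2 -Re_sum4 e.
Qed.

Lemma submxE (M N : 'M[R]_2) a b : (M - N) a b = M a b - N a b.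
Proof. by rewrite mxE [X in _ + X]mxE. Qed.

Lemma hessianE u y a b : hessian u y a b = partial b (partial a u) y.
Proof. by rewrite mxE. Qed.

Lemma Ck_hessian k u : symplectic_potential u -> Ck_mx k (hessian u).
Proof.
move=> up a b; rewrite (_ : (fun y => _) = partial b (partial a u)).
  by do 2![apply: Ck_partial]; exact: Ck_potential.
by apply/funext => y; rewrite hessianE.
Qed.

Lemma periodic_hessian u : symplectic_potential u -> Defs.periodic (hessian u).
Proof.
move=> /potential_decomposition[v [vs vp uE]].
have hE a b : partial b (partial a u) = fun y => (a == b)%:R + partial b (partial a v) y.
  rewrite uE (partial_add 0 _ v a (Ck_half_norm2 1) (smooth_Ck _ _ vs)).
  rewrite partial_half_norm2 (partial_add 0 _ (partial a v) b (Ck_coord 1 a)).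
    by rewrite partial_coord.
  by apply: Ck_partial; exact: smooth_Ck.
move=> y k; apply/matrixP => a b.
rewrite [LHS]hessianE [RHS]hessianE (hE a b).
by rewrite (periodic_partial _ b (periodic_partial _ a vp)).
Qed.

Lemma periodic_potential_sub u1 u2 : symplectic_potential u1 -> symplectic_potential u2 ->
  Defs.periodic (fun y => u2 y - u1 y).
Proof.
move=> /potential_decomposition[v1 [_ v1p ->]] /potential_decomposition[v2 [_ v2p ->]].
by move=> y k; rewrite v1p v2p; lra.
Qed.

Lemma hessian_sub u1 u2 y : symplectic_potential u1 -> symplectic_potential u2 ->
  hessian (fun y => u2 y - u1 y) y = hessian u2 y - hessian u1 y.
Proof.
move=> u1p u2p; apply/matrixP => a b.
rewrite submxE [X in _ = X - _]hessianE [X in _ = _ - X]hessianE [LHS]hessianE.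
rewrite (partial_sub 0 _ _ a (Ck_potential _ _ u2p) (Ck_potential _ _ u1p)).
rewrite (partial_sub 0 _ _ b (Ck_partial 1 _ a (Ck_potential _ _ u2p))
  (Ck_partial 1 _ a (Ck_potential _ _ u1p))).
by [].
Qed.

(** The product-rule expansion of the divergence of W, with every derivative as a free variable. The
    transposed indices in q_ba,b make the first-order terms cancel after relabelling and leave p
    times the moment map sum with its derivatives in the given order. *)
Lemma divergence_identity (p f0 f1 f00 f01 f10 f11 q00 q01 q10 q11
    d0q00 d0q01 d1q10 d1q11 e00 e01 e10 e11 : R) :
  e00 + e01 + (e10 + e11) = 0 ->
  d0q00 * f0 + q00 * f00 + (d0q01 * f1 + q01 * f10)
    - (f0 * (d0q00 + d1q10) + p * (e00 + e10))
  + (d1q10 * f0 + q10 * f01 + (d1q11 * f1 + q11 * f11)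
    - (f1 * (d0q01 + d1q11) + p * (e01 + e11))) =
  q00 * f00 + q01 * f10 + (q10 * f01 + q11 * f11).
Proof. by move=> e0; rewrite -[RHS]subr0 -(mulr0 p) -e0; ring. Qed.

(* Integration by parts: q : D^2 phi is the divergence of
   W_a = q_ab phi_,b - phi q_ba,b when q_ab,ab = 0. *)
Lemma pairing_hessian_eq0 q phi :
  Ck_mx 2 q -> Ck 2 phi -> Defs.periodic q -> Defs.periodic phi ->
  (forall y, \sum_(a < 2) \sum_(b < 2) partial b (partial a (fun z => q z a b)) y = 0) ->
  (forall y, 0 <= \tr (q y *m hessian phi y)) ->
  forall y, \tr (q y *m hessian phi y) = 0.
Proof.
move=> qk phik qp phip q_eq q_ge0.
have phi1 := Ck_pred _ _ phik.
have q1 a b := Ck_pred _ _ (qk a b).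
have dphi1 a : Ck 1 (partial a phi) by exact: (Ck_partial _ _ a phik).
have dq1 a b c : Ck 1 (partial c (fun y => q y a b)) by exact: (Ck_partial _ _ c (qk a b)).
pose W (a : 'I_2) y := q y a 0 * partial 0 phi y + q y a 1 * partial 1 phi y
  - phi y * (partial 0 (fun z => q z 0 a) y + partial 1 (fun z => q z 1 a) y).
have W1 a : Ck 1 (W a).
  apply: Ck_sub.
    by apply: Ck_add; apply: Ck_mul; [exact: q1|exact: dphi1|exact: q1|exact: dphi1].
  by apply: Ck_mul; [exact: phi1|apply: Ck_add; exact: dq1].
have qpe a b : Defs.periodic (fun y => q y a b) by move=> y k; rewrite qp.
have Wp a : Defs.periodic (W a).
  move=> y k; rewrite /W qp phip.
  by rewrite !(periodic_partial _ _ phip) !(periodic_partial _ _ (qpe _ _)).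
have WE a y : partial a (W a) y =
  (partial a (fun z => q z a 0) y * partial 0 phi y
    + q y a 0 * partial a (partial 0 phi) y
   + (partial a (fun z => q z a 1) y * partial 1 phi y
    + q y a 1 * partial a (partial 1 phi) y))
  - (partial a phi y * (partial 0 (fun z => q z 0 a) y + partial 1 (fun z => q z 1 a) y)
     + phi y * (partial a (partial 0 (fun z => q z 0 a)) y
                + partial a (partial 1 (fun z => q z 1 a)) y)).
  apply: derive_val; apply: is_derive_sub.
    by apply: is_derive_add; apply: is_derive_mul;
      [exact: Ck_is_derive (q1 _ _)|exact: Ck_is_derive (dphi1 _)
      |exact: Ck_is_derive (q1 _ _)|exact: Ck_is_derive (dphi1 _)].
  apply: is_derive_mul; first exact: Ck_is_derive phi1.
  by apply: is_derive_add; exact: Ck_is_derive (dq1 _ _ _).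
have divE y : partial 0 (W 0) y + partial 1 (W 1) y = \tr (q y *m hessian phi y).
  rewrite !WE mxtrace2 !mulmx2 !hessianE; apply: divergence_identity.
  by rewrite -(q_eq y) (sum_sum_ord2 (fun a b => partial b (partial a (fun z => q z a b)) y)).
move=> y; rewrite -divE; apply: periodic_divergence_ge0 => // z.
by rewrite divE.
Qed.

End Potentials.

Theorem mainTheorem9 (R : realType) (xi : 'rV[R]_2 -> 'M[R[i]]_2)
  (xi_higgs : higgs_tensor xi)
  (xi_cond : (forall y, semidefmx (re_mx (xi y)) /\ semidefmx (im_mx (xi y)))
             \/ (forall y, \det (xi y) = 0))
  (u1 u2 : 'rV[R]_2 -> R)
  (u1_pot : symplectic_potential u1) (u2_pot : symplectic_potential u2)
  (u1_norm : forall y, higgs_norm2 xi u1 y < 1)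
  (u2_norm : forall y, higgs_norm2 xi u2 y < 1)
  (u1_eq : real_moment_map_equation xi u1)
  (u2_eq : real_moment_map_equation xi u2) :
  exists c : R, forall y, u2 y = u1 y + c.
Proof.
case: xi_higgs => xip xiT xis.
pose A y := re_mx (xi y); pose B y := im_mx (xi y).
have AT y : (A y)^T = A y by rewrite /A re_mxT xiT.
have BT y : (B y)^T = B y by rewrite /B im_mxT xiT.
(* Both alternatives for [xi] act through this single inequality, applied to the two Hessians and to
   their difference. *)
have form_ge0 y H : H^T = H -> 0 <= higgs_form (A y) (B y) H H.
  case: xi_cond => [/(_ y)[As Bs]|/(_ y) d0]; first exact: higgs_form_ge0.
  by apply: higgs_form_det0 => //; exact: det_norm2_eq0.
have Ak : Ck_mx 2 A by move=> a b; apply: smooth_Ck; exact: (xis a b).1.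
have Bk : Ck_mx 2 B by move=> a b; apply: smooth_Ck; exact: (xis a b).2.
have key u : symplectic_potential u -> (forall y, higgs_norm2 xi u y < 1) ->
    real_moment_map_equation xi u ->
    [/\ forall y, higgs_form (A y) (B y) (hessian u y) (hessian u y) < 1,
        Ck_mx 2 (fun y => moment_mx (A y) (B y) (hessian u y)),
        Defs.periodic (fun y => moment_mx (A y) (B y) (hessian u y))
      & forall y, \sum_(a < 2) \sum_(b < 2) partial b (partial a
          (fun z => moment_mx (A z) (B z) (hessian u z) a b)) y = 0].
  move=> up un ueq.
  have Gp y : posdefmx (hessian u y) := up.2 y.
  have re y := moment_tensor_re xi u y (xiT y) (Gp y) (un y) (form_ge0 y _ (Gp y).1).
  have t1 y := (re y).1.
  have bounds y := norm_det_lt _ _ _ (AT y) (BT y) (Gp y)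
    (introT andP (conj (form_ge0 y _ (Gp y).1) (t1 y))).
  split.
  - exact: t1.
  - apply: Ck_moment_mx.
    + exact: Ak.
    + exact: Bk.
    + exact: Ck_hessian.
    + by move=> y; have [] := posdef_entries _ (Gp y).
    + exact: t1.
    + by move=> y; exact: (bounds y).1.
    + by move=> y; exact: (bounds y).2.
  - by move=> y k; rewrite /A /B xip periodic_hessian.
  - have mE a b : (fun z => complex.Re (moment_tensor xi u z a b))
        = (fun z => moment_mx (A z) (B z) (hessian u z) a b).
      by apply/funext => z; rewrite -(re z).2 [RHS]re_mxE.
    move=> y; under eq_bigr do under eq_bigr do rewrite -mE.
    exact: (re_cpartial2_sum (fun a b z => moment_tensor xi u z a b) y (ueq y)).
have [t1 m1k m1p m1eq] := key _ u1_pot u1_norm u1_eq.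
have [t2 m2k m2p m2eq] := key _ u2_pot u2_norm u2_eq.
have mono y := moment_mx_monotone (A y) (B y) (hessian u1 y) (hessian u2 y)
  (AT y) (BT y) (form_ge0 y) (u1_pot.2 y) (u2_pot.2 y) (t1 y) (t2 y).
have phik k : Ck k (fun y => u2 y - u1 y) by apply: Ck_sub; exact: Ck_potential.
have phip := periodic_potential_sub _ _ u1_pot u2_pot.
pose q y := moment_mx (A y) (B y) (hessian u2 y) - moment_mx (A y) (B y) (hessian u1 y).
have qk : Ck_mx 2 q by exact: Ck_submx.
have qp : Defs.periodic q by move=> z k; exact: (f_equal2 (fun M N => M - N) (m2p z k) (m1p z k)).
have hE y := hessian_sub u1 u2 y u1_pot u2_pot.
have qge y : 0 <= \tr (q y *m hessian (fun z => u2 z - u1 z) y).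
  by rewrite hE; exact: (mono y).1.
have qeq z : \sum_(a < 2) \sum_(b < 2) partial b (partial a (fun y => q y a b)) z = 0.
  have sE a b : (fun y => q y a b) = (fun y => moment_mx (A y) (B y) (hessian u2 y) a b
     - moment_mx (A y) (B y) (hessian u1 y) a b).
    by apply/funext => t; exact: submxE.
  rewrite -[RHS](sum_partial2_sub (fun a b y => moment_mx (A y) (B y) (hessian u2 y) a b)
    (fun a b y => moment_mx (A y) (B y) (hessian u1 y) a b) z m2k m1k (m2eq z) (m1eq z)).
  by apply: eq_bigr => a _; apply: eq_bigr => b _; rewrite sE.
have I0 := pairing_hessian_eq0 q _ qk (phik 2%N) qp phip qeq qge.
have GE y : hessian u1 y = hessian u2 y.
  by apply: (mono y).2; have := I0 y; rewrite hE.
exists (u2 0 - u1 0) => y.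
have : u2 y - u1 y = u2 0 - u1 0.
  apply: (periodic_hessian0_constant (fun y => u2 y - u1 y) (phik 2%N) phip).
  move=> a b z; have /matrixP/(_ a b) := hE z.
  by rewrite GE subrr [in RHS]mxE hessianE.
by move=> e; rewrite -(subrK (u1 y) (u2 y)) e addrC.
Qed.
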